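(* Let $G,H$ be locally compact second countable groups such that $G$ is a measure equivalence subgroup of $H$. If $H$ has the Haagerup property (respectively is weakly amenable, respectively has the weak Haagerup property), then $G$ has the Haagerup property (respectively is weakly amenable, respectively has the weak Haagerup property).
   Context: **Non-singular actions.** A non-singular action $G\curvearrowright(X,\mu)$ is a Borel action of a locally compact second countable (l.c.s.c.) group on a standard probability space preserving the class of null sets. **Measure correspondence.** Let $G,H$ be l.c.s.c. groups, equipped with Haar measure. A measure correspondence between $G$ and $H$ is a non-singular action $G\times H\curvearrowright(\Omega,\eta)$ for which there exist standard probability spaces $(X,\mu)$, $(Y,\nu)$ and (almost everywhere defined) measure class preserving Borel isomorphisms $\varphi:X\times H\to\Omega$ and $\psi:Y\times G\to\Omega$ such that for all $h\in H$, $\varphi(x,hk)=h\varphi(x,k)$ for almost all $(x,k)\in X\times H$, and for all $g\in G$, $\psi(y,gk)=g\psi(y,k)$ for almost all $(y,k)\in Y\times G$. Then there are a non-singular action $G\curvearrowright(X,\mu)$ and a Borel map (cocycle) $\omega:G\times X\to H$ such that for every $g\in G$, $g\varphi(x,h)=\varphi(gx,h\,\omega(g,x)^{-1})$ for almost all $(x,h)\in X\times H$; this action is unique up to isomorphism of non-singular actions. **Measure equivalence subgroup.** $G$ is a measure equivalence subgroup of $H$ if there is a measure correspondence between $G$ and $H$ for which the associated action $G\curvearrowright(X,\mu)$ admits a $G$-invariant probability measure on $X$ equivalent to $\mu$. **Herz–Schur multipliers.** A continuous function $\varphi:G\to\mathbb{C}$ is a Herz–Schur multiplier if there are bounded continuous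 maps $\xi,\eta:G\to\mathcal{H}$ into a Hilbert space with $\varphi(g^{-1}h)=\langle\xi_g,\eta_h\rangle$ for all $g,h\in G$. Its norm $\|\varphi\|_{HS}$ is the infimum of $\sup_g\|\xi_g\|\cdot\sup_g\|\eta_g\|$ over all such pairs. **Approximation properties** of an l.c.s.c. group $G$: - Haagerup property: there is a sequence $(\varphi_n)$ of continuous positive type functions $\varphi_n\in C_0(G)$ converging to $1$ uniformly on compact subsets of $G$. - Weakly amenable: there are $C\geq1$ and a sequence $(\varphi_n)$ of continuous compactly supported Herz–Schur multipliers converging to $1$ uniformly on compact sets, with $\|\varphi_n\|_{HS}\leq C$ for all $n$. - Weak Haagerup property: there are $C\geq1$ and a sequence $(\varphi_n)$ of continuous Herz–Schur multipliers $\varphi_n\in C_0(G)$ converging to $1$ uniformly on compact sets, with $\|\varphi_n\|_{HS}\leq C$ for all $n$. *)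

(* Defs.v *)
From HB Require Import structures.
From mathcomp Require Import all_boot all_order all_algebra.
From mathcomp Require Import sesquilinear complex.
From mathcomp Require Import all_classical all_reals all_analysis.

Set Implicit Arguments.
Unset Strict Implicit.
Unset Printing Implicit Defensive.

Import Order.TTheory GRing.Theory Num.Def Num.Theory.
Import numFieldNormedType.Exports.

Local Open Scope classical_set_scope.
Local Open Scope ring_scope.

HB.mixin Record isTopologicalGroup G & Topological G & Group G := {
  mulg_continuous : continuous (fun p : G * G => (p.1 * p.2)%g) ;
  invg_continuous : continuous (fun x : G => x^-1%g)
}.

#[short(type="topologicalGroupType")]
HB.structure Definition TopologicalGroup :=
  {G of Topological G & Group G & isTopologicalGroup G}.

HB.mixin Record isLCSC T & Topological T := {
  lcsc_hausdorff : hausdorff_space T ;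
  lcsc_locally_compact : locally_compact [set: T] ;
  lcsc_second_countable : @second_countable T
}.

(* The distinguished point is irrelevant: it is there only because measurable
   types are pointed. *)
#[short(type="lcscGroupType")]
HB.structure Definition LCSCGroup :=
  {G of TopologicalGroup G & Pointed G & isLCSC G}.

Section product_group.
Variables G H : lcscGroupType.

Let continuous_pair (S T U : topologicalType) (f : S -> T) (g : S -> U) :
  continuous f -> continuous g -> continuous (fun x => (f x, g x)).
Proof. by move=> cf cg x; apply: cvg_pair; [exact: cf|exact: cg]. Qed.

Let fst_continuous (S T : topologicalType) : continuous (@fst S T).
Proof. by move=> x; exact: cvg_fst. Qed.

Let snd_continuous (S T : topologicalType) : continuous (@snd S T).
Proof. by move=> x; exact: cvg_snd. Qed.

Let comp_continuous (S T U : topologicalType) (f : S -> T) (g : T -> U) :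
  continuous f -> continuous g -> continuous (g \o f).
Proof. by move=> cf cg x; apply: continuous_comp; [exact: cf|exact: cg]. Qed.

Let prod_mulg_continuous :
  continuous (fun p : (G * H) * (G * H) => (p.1 * p.2)%g).
Proof.
apply: (@continuous_pair _ _ _
    (fun p : (G * H) * (G * H) => (p.1.1 * p.2.1)%g)
    (fun p : (G * H) * (G * H) => (p.1.2 * p.2.2)%g)).
  apply: (@comp_continuous _ _ _ (fun p : (G * H) * (G * H) => (p.1.1, p.2.1))
    (fun p : G * G => (p.1 * p.2)%g) _ (@mulg_continuous G)).
  by apply: continuous_pair; [apply: (comp_continuous (@fst_continuous _ _))
    |apply: (comp_continuous (@snd_continuous _ _))]; exact: fst_continuous.
apply: (@comp_continuous _ _ _ (fun p : (G * H) * (G * H) => (p.1.2, p.2.2))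
  (fun p : H * H => (p.1 * p.2)%g) _ (@mulg_continuous H)).
by apply: continuous_pair; [apply: (comp_continuous (@fst_continuous _ _))
  |apply: (comp_continuous (@snd_continuous _ _))]; exact: snd_continuous.
Qed.

Let prod_invg_continuous : continuous (fun x : G * H => x^-1%g).
Proof.
by apply: (@continuous_pair _ _ _
    (fun p : G * H => (p.1)^-1%g) (fun p : G * H => (p.2)^-1%g));
  [apply: (comp_continuous (@fst_continuous _ _))
  |apply: (comp_continuous (@snd_continuous _ _))]; exact: invg_continuous.
Qed.

HB.instance Definition _ := isTopologicalGroup.Build (G * H)%type
  prod_mulg_continuous prod_invg_continuous.

Let prod_hausdorff : hausdorff_space (G * H)%type.
Proof.
move=> [a b] [c d] cl; congr (_, _).
  apply: (@lcsc_hausdorff G) => A B aA cB.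
  have [||[x y] [[/= Ax _] [/= Bx _]]] := cl (A `*` setT) (B `*` setT).
  - by exists (A, setT) => //=; split => //; exact: filterT.
  - by exists (B, setT) => //=; split => //; exact: filterT.
  - by exists x.
apply: (@lcsc_hausdorff H) => A B bA dB.
have [||[x y] [[/= _ Ay] [/= _ By]]] := cl (setT `*` A) (setT `*` B).
- by exists (setT, A) => //=; split => //; exact: filterT.
- by exists (setT, B) => //=; split => //; exact: filterT.
- by exists y.
Qed.

Let prod_locally_compact : locally_compact [set: G * H].
Proof.
move=> [a b] _.
have [A aA [cA clA]] := @lcsc_locally_compact G a I.
have [B bB [cB clB]] := @lcsc_locally_compact H b I.
exists (A `*` B).
  exists (A, B) => [|[x y] [/= Ax By] _ //].
  by split; [move: aA|move: bB]; rewrite /within/=; apply: filterS => x; exact.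
split; first exact: compact_setX.
rewrite (_ : A `*` B = fst @^-1` A `&` snd @^-1` B)//.
by apply: closedI; apply: preimage_closed => //; apply: in1W;
  [exact: fst_continuous|exact: snd_continuous].
Qed.

Let prod_second_countable : @second_countable (G * H)%type.
Proof.
have [B cB [oB bB]] := @lcsc_second_countable G.
have [B' cB' [oB' bB']] := @lcsc_second_countable H.
exists ((fun P => P.1 `*` P.2) @` (B `*` B')).
  apply: (card_le_trans (card_image_le _ _)).
  exact: countableX.
split=> [_ [[U V] [/= UB VB] <-]|[a b] W [[U V] /= [aU bV] UVW]].
  rewrite (_ : U `*` V = fst @^-1` U `&` snd @^-1` V)//.
  by apply: openI; apply: open_comp => [x _|];
    [exact: fst_continuous|exact: oB|exact: snd_continuous|exact: oB'].
have [U' /= [BU' U'a] U'U] := bB _ _ aU.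
have [V' /= [BV' V'b] V'V] := bB' _ _ bV.
exists (U' `*` V') => /=; first by split => //; exists (U', V').
by move=> [x y] [/= /U'U Ux /V'V Vy]; exact: UVW.
Qed.

HB.instance Definition _ := isLCSC.Build (G * H)%type
  prod_hausdorff prod_locally_compact prod_second_countable.

End product_group.

Notation borel T := (g_sigma_algebraType (@open T)).

(* On a second countable group these conditions imply sigma-finiteness and
   regularity. *)
Definition haar_measure (R : realType) (G : lcscGroupType)
    (lam : set (borel G) -> \bar R) : Prop :=
  [/\ lam setT != 0%E,
      forall K : set G, compact K -> (lam K < +oo)%E &
      forall (g : G) (A : set (borel G)), measurable A ->
        lam [set k | A (g * k)%g] = lam A].

(* X is Borel isomorphic to a Polish space. *)
Definition standard_borel (R : realType) d (X : measurableType d) : Prop :=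
  exists (T : completePseudoMetricType R) (f : X -> borel T) (g : borel T -> X),
    [/\ hausdorff_space T, @second_countable T, cancel f g, cancel g f &
        measurable_fun setT f /\ measurable_fun setT g].

Definition nonsingular_action (R : realType) (G : lcscGroupType) d
    (X : measurableType d) (mu : probability X R) (act : G -> X -> X) : Prop :=
  [/\ standard_borel R X,
      forall x, act 1%g x = x,
      forall g h x, act (g * h)%g x = act g (act h x),
      measurable_fun setT (fun p : borel G * X => act p.1 p.2) &
      forall g A, measurable A -> (mu (act g @^-1` A) = 0%E <-> mu A = 0%E)].

(* An almost everywhere defined, measure class preserving Borel isomorphism f,
   from a conull set D onto a conull set E; the values of f outside D are
   irrelevant. *)
Definition mcp_isomorphism (R : realType) d1 d2 (T1 : measurableType d1)
    (T2 : measurableType d2) (m1 : set T1 -> \bar R) (m2 : set T2 -> \bar R)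
    (f : T1 -> T2) : Prop :=
  exists (D : set T1) (E : set T2) (g : T2 -> T1),
  [/\ [/\ measurable D, measurable E, m1 (~` D) = 0%E & m2 (~` E) = 0%E],
      [/\ f @` D `<=` E, g @` E `<=` D, {in D, cancel f g} &
          {in E, cancel g f}],
      measurable_fun D f, measurable_fun E g &
      forall A, measurable A -> (m1 (D `&` f @^-1` A) = 0%E <-> m2 A = 0%E)].

Section measure_correspondence.
Context {R : realType} {G H : lcscGroupType}.
Variables (lamG : {sigma_finite_measure set (borel G) -> \bar R})
          (lamH : {sigma_finite_measure set (borel H) -> \bar R}).

(* phi identifies Omega with X * K, where K acts by translation on the second
   factor. *)
Definition equivariant_splitting (K : lcscGroupType)
    (lamK : {sigma_finite_measure set (borel K) -> \bar R})
    dO (Omega : measurableType dO) (eta : probability Omega R)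
    (act : K -> Omega -> Omega)
    d (X : measurableType d) (mu : probability X R)
    (phi : X * borel K -> Omega) : Prop :=
  [/\ standard_borel R X,
      mcp_isomorphism (mu \x lamK)%E eta phi &
      forall h : K, \forall p \ae (mu \x lamK)%E,
        phi (p.1, (h * p.2)%g) = act h (phi p)].

Definition measure_correspondence dO (Omega : measurableType dO)
    (eta : probability Omega R) (act : G * H -> Omega -> Omega) : Prop :=
  [/\ nonsingular_action eta act,
      exists d (X : measurableType d) (mu : probability X R)
        (phi : X * borel H -> Omega),
        equivariant_splitting lamH eta (fun h => act (1%g, h)) mu phi &
      exists d (Y : measurableType d) (nu : probability Y R)
        (psi : Y * borel G -> Omega),
        equivariant_splitting lamG eta (fun g => act (g, 1%g)) nu psi].

(* The cocycle identity is in fact a consequence of the last condition, since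
   phi is injective almost everywhere. *)
Definition associated_action dO (Omega : measurableType dO)
    (act : G * H -> Omega -> Omega)
    d (X : measurableType d) (mu : probability X R)
    (phi : X * borel H -> Omega)
    (actX : G -> X -> X) (omega : G * X -> H) : Prop :=
  [/\ nonsingular_action mu actX,
      measurable_fun setT (omega : borel G * X -> borel H),
      forall g k : G, \forall x \ae mu,
        omega ((g * k)%g, x) = (omega (g, actX k x) * omega (k, x))%g &
      forall g : G, \forall p \ae (mu \x lamH)%E,
        act (g, 1%g) (phi p) = phi (actX g p.1, (p.2 * (omega (g, p.1))^-1)%g)].

(* X, mu, phi and the associated action are determined by the correspondence
   up to isomorphism, so it does not matter which ones are chosen. *)
Definition measure_equivalence_subgroup : Prop :=
  exists dO (Omega : measurableType dO) (eta : probability Omega R)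
    (act : G * H -> Omega -> Omega),
    measure_correspondence eta act /\
  exists d (X : measurableType d) (mu : probability X R)
    (phi : X * borel H -> Omega) (actX : G -> X -> X) (omega : G * X -> H),
    [/\ equivariant_splitting lamH eta (fun h => act (1%g, h)) mu phi,
        associated_action act mu phi actX omega &
    exists mu' : probability X R,
      [/\ mu `<< mu', mu' `<< mu &
          forall g A, measurable A -> mu' (actX g @^-1` A) = mu' A]].

End measure_correspondence.

(* {dot V for conjC} is linear in its first argument. *)
Record hilbertSpace (R : realType) := HilbertSpace {
  hilbert_sort :> completeNormedModType R[i] ;
  inner : {dot hilbert_sort for conjC} ;
  inner_norm : forall v : hilbert_sort, inner v v = `|v| ^+ 2
}.

(* R[i] carries its norm topology under the alias R[i]^o. *)
Section herz_schur.
Context {R : realType}.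

(* The norm of a normed module over R[i] takes its values in R[i]. *)
Definition hnorm (V : hilbertSpace R) (v : V) : R := complex.Re `|v|.

Context {G : lcscGroupType}.

Definition bounded_continuous (V : hilbertSpace R) (xi : G -> V) : Prop :=
  continuous xi /\ exists M : R, forall g, hnorm (xi g) <= M.

Definition herz_schur_representation (phi : G -> R[i]^o)
    (V : hilbertSpace R) (xi eta : G -> V) : Prop :=
  [/\ bounded_continuous xi, bounded_continuous eta &
      forall g h : G, phi (g^-1 * h)%g = inner V (xi g) (eta h)].

Definition herz_schur_multiplier (phi : G -> R[i]^o) : Prop :=
  continuous phi /\ exists (V : hilbertSpace R) (xi eta : G -> V),
    herz_schur_representation phi xi eta.

Definition herz_schur_norm (phi : G -> R[i]^o) : R :=
  inf [set c | exists (V : hilbertSpace R) (xi eta : G -> V),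
    herz_schur_representation phi xi eta /\
    c = sup (range (fun g => hnorm (xi g))) *
        sup (range (fun g => hnorm (eta g)))].

Definition positive_type (phi : G -> R[i]^o) : Prop :=
  forall (n : nat) (g : 'I_n -> G) (c : 'I_n -> R[i]),
    0 <= \sum_i \sum_j conjC (c i) * c j * (phi ((g i)^-1 * g j)%g : R[i]).

Definition vanishes_at_infinity (phi : G -> R[i]^o) : Prop :=
  forall e : R, 0 < e -> exists2 K : set G, compact K &
    forall g, ~ K g -> complex.Re `|phi g| < e.

Definition compactly_supported (phi : G -> R[i]^o) : Prop :=
  compact (closure [set g | phi g != 0]).

Definition cvg_to_1_on_compacts (phi : nat -> G -> R[i]^o) : Prop :=
  {family compact, phi @ \oo --> (cst 1 : G -> R[i]^o)}.

End herz_schur.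

Section approximation_properties.
Variables (R : realType) (G : lcscGroupType).

Definition haagerup_property : Prop :=
  exists phi : nat -> G -> R[i]^o,
    (forall n, [/\ continuous (phi n), positive_type (phi n) &
                   vanishes_at_infinity (phi n)]) /\
    cvg_to_1_on_compacts phi.

Definition weakly_amenable : Prop :=
  exists (C : R) (phi : nat -> G -> R[i]^o),
    [/\ 1 <= C,
        forall n, [/\ herz_schur_multiplier (phi n),
                      compactly_supported (phi n) &
                      herz_schur_norm (phi n) <= C] &
        cvg_to_1_on_compacts phi].

Definition weak_haagerup_property : Prop :=
  exists (C : R) (phi : nat -> G -> R[i]^o),
    [/\ 1 <= C,
        forall n, [/\ herz_schur_multiplier (phi n),
                      vanishes_at_infinity (phi n) &
                      herz_schur_norm (phi n) <= C] &
        cvg_to_1_on_compacts phi].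

End approximation_properties.

(* Main.v *)
From HB Require Import structures.
Require Import Defs.
From mathcomp Require Import all_boot all_order all_algebra.
From mathcomp Require Import sesquilinear complex ring lra.
From mathcomp Require Import all_classical all_reals all_analysis.
From mathcomp Require Import measurable_realfun.

Set Implicit Arguments.
Unset Strict Implicit.
Unset Printing Implicit Defensive.

Import Order.TTheory GRing.Theory Num.Def Num.Theory.
Import numFieldNormedType.Exports.

Local Open Scope classical_set_scope.
Local Open Scope ring_scope.

(** The multipliers of H are transferred to G by integration along the cocycle.
    Given phi on H, the function of r in G that integrates phi (omega (r, x)) over x, for
    the invariant probability, is again of the same kind. After the substitution
    y = t x its value at s^-1 t is the integral over y of
    phi (omega (s^-1, y) * omega (t^-1, y)^-1) ([cocycle_kernel_integrated]). For each
    y this is a kernel phi (h^-1 * h') at h = omega (s^-1, y)^-1 and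
    h' = omega (t^-1, y)^-1, so positivity is inherited pointwise. Herz-Schur
    multipliers are treated as off-diagonal blocks of positive semidefinite kernels
    on H * bool ([multiplier_kernel]), so that they and functions of positive type
    are covered by one argument.

    Continuity in r, and uniform convergence on compact sets, are obtained by
    averaging: the kernel is integrated in both variables over a compact set U of G,
    against normalized Haar measure P. The translates of P vary continuously in
    total variation ([averaging_probability]), hence averaged kernels are
    equicontinuous, uniformly for kernels with a common bound
    ([smooth_equicontinuous]), and pointwise convergence, given by dominated
    convergence, is enough ([transferred_cvg]). The averaged kernel is positive
    semidefinite ([cint_psd], [smooth_psd]); a continuous positive semidefinite kernel
    is a Gram kernel of continuous maps into the space of square-summable sequences,
    by Cholesky factorization along a dense sequence ([kernel_representation]), and
    this gives the bound on the Herz-Schur norm.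

    Vanishing at infinity, and compact support, rest on the properness of the
    cocycle ([cocycle_proper]): up to a small part of X, the cocycle takes values in a
    compact subset of H only for r in a compact subset of G. This is where
    the identification of Omega with Y * G enters: its G-coordinate, read on X * H, is
    equivariant, and for most x it takes most of a set of positive measure into a
    compact set. For compact supports the integral is restricted to the good part
    of X, which becomes larger as the multipliers converge to 1. *)

(** * Square-summable sequences *)

Definition sqn (R : realType) (z : R[i]) : R := complex.Re z ^+ 2 + complex.Im z ^+ 2.

Section sqn.
Variable R : realType.
Implicit Types z w : R[i].

Lemma sqn_ge0 z : 0 <= sqn z.
Proof. by rewrite addr_ge0 ?sqr_ge0. Qed.

Lemma sqnD z w : sqn (z + w) <= 2 * sqn z + 2 * sqn w.
Proof.
case: z w => [a b] [c d]; rewrite /sqn /= -subr_ge0.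
have -> : 2 * (a ^+ 2 + b ^+ 2) + 2 * (c ^+ 2 + d ^+ 2) -
    ((a + c) ^+ 2 + (b + d) ^+ 2) = (a - c) ^+ 2 + (b - d) ^+ 2 by ring.
by rewrite addr_ge0 ?sqr_ge0.
Qed.

Lemma sqnM z w : sqn (z * w) = sqn z * sqn w.
Proof. by case: z w => [a b] [c d]; rewrite /sqn /=; ring. Qed.

End sqn.

Definition l2pred (R : realType) : {pred nat -> R[i]^o} :=
  fun x => `[< exists M : R, forall N : nat, \sum_(0 <= n < N) sqn (x n : R[i]) <= M >].

Lemma l2pred_submod (R : realType) : submod_closed (@l2pred R).
Proof.
split=> [|a x y].
  apply/asboolP; exists 0 => N; rewrite big1// => i _.
  by rewrite /sqn /= expr0n addr0.
move=> /asboolP[M xM] /asboolP[M' yM]; apply/asboolP.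
exists (2 * (sqn a * M) + 2 * M') => N.
apply: (@le_trans _ _ (\sum_(0 <= n < N) (2 * (sqn a * sqn (x n : R[i])) + 2 * sqn (y n : R[i])))).
  by apply: ler_sum => n _; rewrite -sqnM; exact: sqnD.
rewrite big_split/= -!mulr_sumr.
apply: lerD; rewrite ler_pM2l//.
exact: (ler_wpM2l (sqn_ge0 a) (xM N)).
Qed.
HB.instance Definition _ (R : realType) := 
  GRing.isSubmodClosed.Build R[i] (nat -> R[i]^o) (@l2pred R) (@l2pred_submod R).

Record l2 (R : realType) := L2 { l2val :> nat -> R[i]^o ; _ : l2val \in @l2pred R }.
HB.instance Definition _ (R : realType) := [isSub for @l2val R].
HB.instance Definition _ (R : realType) := [Choice of l2 R by <:].
HB.instance Definition _ (R : realType) := [SubChoice_isSubLmodule of l2 R by <:].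

Lemma conjCE (R : realType) (z : R[i]) : conjC z = conjc z.
Proof. by []. Qed.

Section complex_cvg.
Variable R : realType.
Implicit Types (u v : nat -> R[i]) (l m a : R[i]).

Definition ccvg u l :=
  (fun n => complex.Re (u n)) @ \oo --> complex.Re l /\
  (fun n => complex.Im (u n)) @ \oo --> complex.Im l.

Lemma ccvg_unique u l m : ccvg u l -> ccvg u m -> l = m.
Proof.
case: l m => [a b] [c d] [/= ua ub] [/= uc ud].
by congr Complex; [exact: cvg_unique ua uc|exact: cvg_unique ub ud].
Qed.

Lemma eq_ccvg u v l : v =1 u -> ccvg u l -> ccvg v l.
Proof. by move=> /funext ->. Qed.

Lemma ccvgD u v l m : ccvg u l -> ccvg v m -> ccvg (fun n => u n + v n) (l + m).
Proof.
by move=> [ur ui] [vr vi]; split; rewrite raddfD/=;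
  under eq_fun do rewrite raddfD/=; exact: cvgD.
Qed.

Lemma ReM (z w : R[i]) : complex.Re (z * w) = complex.Re z * complex.Re w - complex.Im z * complex.Im w.
Proof. by case: z w => [a b] [c d]. Qed.

Lemma ImM (z w : R[i]) : complex.Im (z * w) = complex.Re z * complex.Im w + complex.Im z * complex.Re w.
Proof. by case: z w => [a b] [c d]. Qed.

Lemma ccvgZ u a l : ccvg u l -> ccvg (fun n => a * u n) (a * l).
Proof.
move=> [ur ui]; split; rewrite (ReM, ImM); under eq_fun do rewrite (ReM, ImM).
  by apply: cvgB; exact: cvgMr.
by apply: cvgD; exact: cvgMr.
Qed.

Lemma ccvg_conj u l : ccvg u l -> ccvg (fun n => conjC (u n)) (conjC l).
Proof.
have cr (z : R[i]) : complex.Re (conjC z) = complex.Re z by case: z.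
have ci (z : R[i]) : complex.Im (conjC z) = - complex.Im z by case: z.
move=> [ur ui]; split.
  by rewrite cr; under eq_fun do rewrite cr.
by rewrite ci; under eq_fun do rewrite ci; exact: cvgN.
Qed.

Lemma ccvg_ge0 u l : ccvg u l -> (forall n, 0 <= u n) -> 0 <= l.
Proof.
move=> [ur ui] u0; rewrite lecE /=; apply/andP; split.
  apply/eqP; apply: (cvg_unique _ ui) => //.
  rewrite (_ : (fun _ => _) = cst 0); first exact: cvg_cst.
  by apply/funext => n; have := u0 n; rewrite lecE /= => /andP[/eqP].
rewrite -(cvg_lim _ ur)//; apply: limr_ge; first by apply/cvg_ex; exists (complex.Re l).
by apply: nearW => n; have := u0 n; rewrite lecE /= => /andP[].
Qed.

End complex_cvg.

Section l2_dot.
Variable R : realType.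
Implicit Types (x y z : l2 R) (a : R[i]).

Definition l2psum x y (N : nat) : R[i] :=
  \sum_(0 <= n < N) (x n : R[i]) * conjC (y n : R[i]).

Definition l2dot x y : R[i] :=
  Complex (limn (fun N => complex.Re (l2psum x y N))) (limn (fun N => complex.Im (l2psum x y N))).

Lemma cvgn_dominated_series (u : nat -> R) x y :
  (forall n, `|u n| <= sqn (x n : R[i]) + sqn (y n : R[i])) ->
  cvgn (fun N => \sum_(0 <= n < N) u n).
Proof.
move=> ule; apply: normed_cvg.
apply: (@series_le_cvg _ _ (fun n => sqn (x n : R[i]) + sqn (y n : R[i]))) => //.
- by move=> n /=; exact: normr_ge0.
- by move=> n; rewrite addr_ge0 ?sqn_ge0.
have := valP x; have := valP y => /asboolP[M' yM] /asboolP[M xM].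
apply: nondecreasing_is_cvgn.
  apply: nondecreasing_series => n _ _.
  by rewrite addr_ge0 ?sqn_ge0.
exists (M + M') => _ [N _ <-]; rewrite /series/= big_split/=.
by apply: lerD; [exact: xM|exact: yM].
Qed.

Lemma l2dotP x y : ccvg (l2psum x y) (l2dot x y).
Proof.
have H (z w : R[i]) : `|complex.Re (z * conjC w)| <= sqn z + sqn w /\
    `|complex.Im (z * conjC w)| <= sqn z + sqn w.
  case: z w => [a b] [c d]; rewrite /sqn /= !ler_norml.
  have := (sqr_ge0 (a + c), sqr_ge0 (a - c), sqr_ge0 (b + d), sqr_ge0 (b - d)).
  have := (sqr_ge0 (a + d), sqr_ge0 (a - d), sqr_ge0 (b + c), sqr_ge0 (b - c)).
  have := (sqr_ge0 a, sqr_ge0 b, sqr_ge0 c, sqr_ge0 d).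
  move=> [[[p1 p2] p3] p4] [[[q1 q2] q3] q4] [[[r1 r2] r3] r4].
  by split; apply/andP; split; lra.
split=> /=.
  rewrite (_ : (fun N => _) = fun N => \sum_(0 <= n < N) complex.Re ((x n : R[i]) * conjC (y n : R[i]))).
    by apply: cvgn_dominated_series => n; exact: (H _ _).1.
  by apply/funext => N; rewrite /l2psum raddf_sum.
rewrite (_ : (fun N => _) = fun N => \sum_(0 <= n < N) complex.Im ((x n : R[i]) * conjC (y n : R[i]))).
  by apply: cvgn_dominated_series => n; exact: (H _ _).2.
by apply/funext => N; rewrite /l2psum raddf_sum.
Qed.

Lemma l2dotDl x y z : l2dot (x + y) z = l2dot x z + l2dot y z.
Proof.
apply: (ccvg_unique (l2dotP _ _)); apply: eq_ccvg (ccvgD (l2dotP x z) (l2dotP y z)) => N.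
by rewrite /l2psum -big_split/=; apply: eq_bigr => n _; rewrite -mulrDl.
Qed.

Lemma l2dotZl a x y : l2dot (a *: x) y = a * l2dot x y.
Proof.
apply: (ccvg_unique (l2dotP _ _)); apply: eq_ccvg (ccvgZ a (l2dotP x y)) => N.
by rewrite /l2psum big_distrr/=; apply: eq_bigr => n _; rewrite mulrA.
Qed.

Lemma l2dotC x y : l2dot x y = conjC (l2dot y x).
Proof.
apply: (ccvg_unique (l2dotP _ _)); apply: eq_ccvg (ccvg_conj (l2dotP y x)) => N.
rewrite /l2psum rmorph_sum; apply: eq_bigr => n _.
by rewrite rmorphM/= conjCK mulrC.
Qed.

Lemma l2dotDr x y z : l2dot x (y + z) = l2dot x y + l2dot x z.
Proof. by rewrite l2dotC l2dotDl rmorphD/= -!l2dotC. Qed.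

Lemma l2dotZr a x y : l2dot x (a *: y) = conjC a * l2dot x y.
Proof. by rewrite l2dotC l2dotZl rmorphM/= -l2dotC. Qed.

Lemma mulCJ (z : R[i]) : z * conjC z = (sqn z)%:C%C.
Proof. by case: z => [a b]; rewrite /sqn; simpc; congr Complex; ring. Qed.

Lemma l2dotxx_ge0 x : 0 <= l2dot x x.
Proof.
apply: (ccvg_ge0 (l2dotP x x)) => N; apply: sumr_ge0 => n _.
by rewrite mulCJ ler0c sqn_ge0.
Qed.

Definition l2sq x : R := complex.Re (l2dot x x).

Lemma l2sqE x : (l2sq x)%:C%C = l2dot x x.
Proof. by rewrite RRe_real// ger0_real// l2dotxx_ge0. Qed.

Lemma l2sq_cvg x : (fun N => \sum_(0 <= n < N) sqn (x n : R[i])) @ \oo --> l2sq x.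
Proof.
rewrite (_ : (fun N => _) = (fun N => complex.Re (l2psum x x N))).
  by have [] := l2dotP x x.
apply/funext => N; rewrite /l2psum raddf_sum; apply: eq_bigr => n _.
by rewrite mulCJ.
Qed.

Lemma l2sq_ge x N : \sum_(0 <= n < N) sqn (x n : R[i]) <= l2sq x.
Proof.
rewrite -(cvg_lim _ (@l2sq_cvg x))//.
apply: nondecreasing_cvgn_le; last by apply/cvg_ex; exists (l2sq x); exact: (@l2sq_cvg x).
by apply: nondecreasing_series => n _ _; exact: sqn_ge0.
Qed.

Lemma l2sq_le x M : (forall N, \sum_(0 <= n < N) sqn (x n : R[i]) <= M) -> l2sq x <= M.
Proof.
move=> xM; rewrite -(cvg_lim _ (@l2sq_cvg x))//.
apply: limr_le; first by apply/cvg_ex; exists (l2sq x); exact: (@l2sq_cvg x).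
by apply: nearW => N; exact: xM.
Qed.

Lemma l2sq_ge0 x : 0 <= l2sq x.
Proof. by have := l2sq_ge x 0; rewrite big_nil. Qed.

Lemma l2sq_eq0 x : l2sq x = 0 -> x = 0.
Proof.
move=> x0; apply/val_inj/funext => n /=.
have := l2sq_ge x n.+1; rewrite x0 big_nat_recr//= => H.
have : sqn (x n : R[i]) <= 0.
  apply: le_trans H; rewrite lerDr sumr_ge0// => i _; exact: sqn_ge0.
case: (l2val x n) => a b; rewrite /sqn /= => H'.
have a0 : a = 0 by nra.
have b0 : b = 0 by nra.
by rewrite a0 b0.
Qed.

Definition l2norm x : R[i] := (Num.sqrt (l2sq x))%:C%C.

Lemma l2sqD x y : l2sq (x + y) = l2sq x + l2sq y + 2 * complex.Re (l2dot x y).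
Proof.
rewrite /l2sq.
have -> : l2dot (x + y) (x + y) = l2dot x x + l2dot y y + (l2dot x y + conjC (l2dot x y)).
  by rewrite l2dotDl !l2dotDr -l2dotC; ring.
by case: (l2dot x x) (l2dot y y) (l2dot x y) => [a b] [c d] [e f] /=; ring.
Qed.

Lemma l2sqZ a x : l2sq (a *: x) = sqn a * l2sq x.
Proof.
apply: complexI; rewrite l2sqE l2dotZl l2dotZr mulrA mulCJ -l2sqE.
by rewrite rmorphM.
Qed.

Lemma l2dot_Re_le x y : complex.Re (l2dot x y) <= Num.sqrt (l2sq x) * Num.sqrt (l2sq y).
Proof.
set s := Num.sqrt (l2sq x); set t := Num.sqrt (l2sq y).
have s0 : 0 <= s by exact: sqrtr_ge0.
have t0 : 0 <= t by exact: sqrtr_ge0.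
have sE : l2sq x = s ^+ 2 by rewrite sqr_sqrtr ?l2sq_ge0.
have tE : l2sq y = t ^+ 2 by rewrite sqr_sqrtr ?l2sq_ge0.
have l0 z : l2dot 0 z = 0 by rewrite -(scale0r (0 : l2 R)) l2dotZl mul0r.
have r0 z : l2dot z 0 = 0 by rewrite l2dotC l0 rmorph0.
have [s_eq0|s_neq0] := eqVneq s 0.
  by rewrite (l2sq_eq0 (x := x)) ?l0 ?sE ?s_eq0 ?mul0r ?expr0n.
have [t_eq0|t_neq0] := eqVneq t 0.
  by rewrite (l2sq_eq0 (x := y)) ?r0 ?tE ?t_eq0 ?mulr0 ?expr0n.
have st : 0 < s * t by rewrite mulr_gt0// lt_def ?s_neq0 ?t_neq0.
have := l2sq_ge0 (t%:C%C *: x + (- s)%:C%C *: y).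
rewrite l2sqD !l2sqZ l2dotZl l2dotZr sE tE /sqn /=.
move: (l2dot x y) => [a b] /= H.
rewrite -subr_ge0 -(pmulr_rge0 _ st); lra.
Qed.

Lemma l2normD x y : l2norm (x + y) <= l2norm x + l2norm y.
Proof.
rewrite /l2norm -rmorphD lecR -[leRHS]ger0_norm ?addr_ge0 ?sqrtr_ge0//.
rewrite -sqrtr_sqr ler_wsqrtr// l2sqD sqrrD !sqr_sqrtr ?l2sq_ge0//.
have := l2dot_Re_le x y; lra.
Qed.

Lemma l2normZ a x : l2norm (a *: x) = `|a| * l2norm x.
Proof.
by rewrite /l2norm l2sqZ sqrtrM ?sqn_ge0// rmorphM normc_def.
Qed.

Lemma l2norm_eq0 x : l2norm x = 0 -> x = 0.
Proof.
move=> /complexI /eqP; rewrite sqrtr_eq0 => H; apply: l2sq_eq0.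
by apply/eqP; rewrite eq_le H l2sq_ge0.
Qed.

HB.instance Definition _ := @Lmodule_isNormed.Build R[i] (l2 R) l2norm l2normD l2normZ l2norm_eq0.
End l2_dot.

Lemma l2_norm_ltE (R : realType) (x : l2 R) (e : R) : 0 < e -> (`|x| < e%:C%C) = (l2sq x < e ^+ 2).
Proof.
move=> e0; rewrite [`|x|]/(l2norm x) ltcR -[X in _ < X]ger0_norm ?ltW// -sqrtr_sqr.
by rewrite ltr_sqrt// exprn_gt0.
Qed.

Section l2_complete.
Variable R : realType.
Implicit Types (x y : l2 R).

Lemma l2_norm_leE x (e : R) : 0 <= e -> (`|x| <= e%:C%C) = (l2sq x <= e ^+ 2).
Proof.
move=> e0; rewrite [`|x|]/(l2norm x) lecR -[X in _ <= X]ger0_norm// -sqrtr_sqr.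
by rewrite ler_sqrt// sqr_ge0.
Qed.

Lemma l2sq_lt_coord x y (e : R) n : 0 < e -> `|x - y| < e%:C%C ->
  `|complex.Re (x n : R[i]) - complex.Re (y n : R[i])| < e /\
  `|complex.Im (x n : R[i]) - complex.Im (y n : R[i])| < e.
Proof.
move=> e0; rewrite l2_norm_ltE// => xy.
have := l2sq_ge (x - y) n.+1; rewrite big_nat_recr//= => H.
have {H} : sqn ((x n : R[i]) - (y n : R[i])) < e ^+ 2.
  apply: le_lt_trans xy; apply: le_trans H; rewrite lerDr sumr_ge0// => i _; exact: sqn_ge0.
case: (x n : R[i]) (y n : R[i]) => [a b] [c d]; rewrite /sqn /= => H.
have H1 := sqr_ge0 (a - c); have H2 := sqr_ge0 (b - d).
by split; rewrite -(@ltr_pXn2r _ 2)// ?nnegrE ?normr_ge0 ?ltW// real_normK ?num_real//; lra.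
Qed.

(** A Cauchy filter converges coordinatewise, and the bounds on finite partial sums
    pass to the coordinatewise limit. *)
Lemma l2_complete (F : set_system (l2 R)) : ProperFilter F -> cauchy F -> cvg F.
Proof.
move=> FF Fc.
have Fball (e : R) : 0 < e -> exists x0, F [set x | `|x0 - x| < e%:C%C].
  move=> e0; have e0' : 0 < e%:C%C by rewrite ltcR.
  have /cauchyP/(_ _ e0')[x0 Fx] := Fc.
  by exists x0; rewrite -ball_normE in Fx.
have cv (p : l2 R -> R) :
    (forall x y e, 0 < e -> `|x - y| < e%:C%C -> `|p x - p y| < e) -> cvg (p @ F).
  move=> pc; apply: cauchy_cvg; apply/cauchy_exP => e e0.
  have [x0 Fx] := Fball e e0; exists (p x0).
  apply: (@filterS _ F _ _ (p @^-1` ball (p x0) e) _ Fx) => x /= /(pc _ _ _ e0).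
  by rewrite -ball_normE.
have cr n : cvg ((fun x : l2 R => complex.Re (x n : R[i])) @ F).
  by apply: cv => x y e e0 /(l2sq_lt_coord n e0)[].
have ci n : cvg ((fun x : l2 R => complex.Im (x n : R[i])) @ F).
  by apply: cv => x y e e0 /(l2sq_lt_coord n e0)[].
pose f n : R[i]^o := Complex (lim ((fun x : l2 R => complex.Re (x n : R[i])) @ F))
  (lim ((fun x : l2 R => complex.Im (x n : R[i])) @ F)).
have bnd (e : R) (x0 : l2 R) : 0 < e -> F [set x | `|x0 - x| < e%:C%C] ->
    forall N, \sum_(0 <= n < N) sqn ((x0 n : R[i]) - f n) <= e ^+ 2.
  move=> e0 Fx N.
  have S : (fun x : l2 R => \sum_(0 <= n < N) sqn ((x0 n : R[i]) - (x n : R[i]))) @ F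
      --> \sum_(0 <= n < N) sqn ((x0 n : R[i]) - f n).
    apply: cvg_big => [|n _]; first exact: add_continuous.
    have E (z w : R[i]) : 
        sqn (z - w) = (complex.Re z - complex.Re w) ^+ 2 + (complex.Im z - complex.Im w) ^+ 2.
      by case: z w => [a b] [c d].
    rewrite E; under eq_fun do rewrite E.
    apply: cvgD; rewrite expr2; under eq_fun do rewrite expr2.
      by apply: cvgM; apply: cvgB; try exact: cvg_cst; exact: cr.
    by apply: cvgM; apply: cvgB; try exact: cvg_cst; exact: ci.
  rewrite -(cvg_lim _ S)//; apply: limr_le; first by apply/cvg_ex; eexists; exact: S.
  apply: filterS Fx => x /=; rewrite l2_norm_ltE// => /ltW; apply: le_trans.
  exact: (l2sq_ge (x0 - x) N).
have fl2 : f \in @l2pred R.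
  have [x0 Fx] := Fball 1 ltr01.
  rewrite (_ : f = (x0 : nat -> R[i]^o) - ((x0 : nat -> R[i]^o) - f)); last first.
    by rewrite opprB addrC subrK.
  rewrite rpredB//; first exact: valP.
  by apply/asboolP; exists (1 ^+ 2) => N; exact: bnd.
apply/cvg_ex; exists (L2 fl2); apply/cvgrPdist_lt => /= e e0.
have [er eE] : exists er : R, e = er%:C%C /\ 0 < er.
  by exists (complex.Re e); move: e0; case: e => a b; rewrite ltcE /= => /andP[/eqP -> ->].
case: eE => eE er0; rewrite eE.
have e20 : 0 < er / 2 by rewrite divr_gt0.
have [x0 Fx] := Fball (er / 2) e20.
have : `|x0 - L2 fl2| <= (er / 2)%:C%C.
  rewrite (l2_norm_leE _ (ltW e20)); apply: (@l2sq_le _ (x0 - L2 fl2) _) => N.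
  exact: bnd.
move=> H; apply: filterS Fx => x /= x0x.
rewrite (_ : L2 fl2 - x = - (x0 - L2 fl2) + (x0 - x)); last by rewrite opprB addrA subrK.
apply: (le_lt_trans (ler_normD _ _)); rewrite normrN.
rewrite (_ : er%:C%C = (er / 2)%:C%C + (er / 2)%:C%C); last by rewrite -rmorphD/=; congr (_%:C%C); lra.
exact: ler_ltD.
Qed.
HB.instance Definition _ := Uniform_isComplete.Build (l2 R) l2_complete.

Lemma l2dot_bilinear : bilinear_for (GRing.Scale.Law.clone _ _ ( *%R ) _)
  (GRing.Scale.Law.clone _ _ (conjC \; *%R ) _) (@l2dot R : l2 R -> l2 R -> R[i]).
Proof.
split=> [y|x] a u v /=; first by rewrite l2dotDl l2dotZl.
by rewrite l2dotDr l2dotZr.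
Qed.
HB.instance Definition _ := bilinear_isBilinear.Build R[i] (l2 R) (l2 R) R[i] _ _ (@l2dot R) l2dot_bilinear.

Lemma l2dot_hermitian x y : l2dot x y = (-1) ^+ false * conjC (l2dot y x).
Proof. by rewrite expr0 mul1r -l2dotC. Qed.
HB.instance Definition _ := isHermitianSesquilinear.Build R[i] (l2 R) false conjC (@l2dot R) l2dot_hermitian.

Lemma l2dot_gt0 x : x != 0 -> 0 < l2dot x x.
Proof.
move=> x0; rewrite lt_def l2dotxx_ge0 andbT; apply: contra_neq x0 => xx.
by apply: l2sq_eq0; rewrite /l2sq xx.
Qed.
HB.instance Definition _ := isDotProduct.Build R[i] (l2 R) (@l2dot R) l2dot_gt0.

Lemma l2_inner_norm x : l2dot x x = `|x| ^+ 2.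
Proof.
rewrite [`|x|]/(l2norm x) -rmorphXn/= sqr_sqrtr ?l2sq_ge0//.
by rewrite l2sqE.
Qed.

Definition l2_hilbert : hilbertSpace R :=
  @HilbertSpace R (l2 R) (@l2dot R : {dot l2 R for conjC}) l2_inner_norm.

End l2_complete.

(** * Positive semidefinite kernels *)

Definition psd (R : realType) (S : Type) (K : S -> S -> R[i]) : Prop :=
  forall (n : nat) (s : 'I_n -> S) (c : 'I_n -> R[i]),
    0 <= \sum_i \sum_j conjC (c i) * c j * K (s i) (s j).

Lemma ccvg_sqn (R : realType) (u : nat -> R[i]) (l : R[i]) :
  (forall e, 0 < e -> exists n, forall N, (n <= N)%N -> sqn (u N - l) < e) -> ccvg u l.
Proof.
move=> H; split; apply/cvgrPdist_lt => e e0; have [n nH] := H _ (exprn_gt0 2 e0);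
  exists n => // N /= /nH; move: (u N) l {H nH} => [a b] [c d]; rewrite /sqn /= => h;
  rewrite -(@ltr_pXn2r _ 2)// ?nnegrE ?normr_ge0 ?ltW// real_normK ?num_real//;
  have H1 := sqr_ge0 (a - c); have H2 := sqr_ge0 (b - d); lra.
Qed.

Section psd_kernel.
Variables (R : realType) (S : Type).
Implicit Types (K : S -> S -> R[i]) (s t u : S).

Lemma psd_two K s t (a b : R[i]) : psd K ->
  0 <= conjC a * a * K s s + conjC a * b * K s t + conjC b * a * K t s + conjC b * b * K t t.
Proof.
move=> /(_ 2 (fun i : 'I_2 => if i == 0 then s else t) (fun i : 'I_2 => if i == 0 then a else b)).
by rewrite !big_ord_recl !big_ord0 /= !addr0 addrA.
Qed.

Lemma psd_diag K s : psd K -> K s s = (complex.Re (K s s))%:C%C /\ 0 <= complex.Re (K s s).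
Proof.
move=> /(@psd_two _ s s 1 0); rewrite rmorph1 rmorph0 !(mul0r, mul1r, addr0).
by case: (K s s) => a b; rewrite lecE /= => /andP[/eqP -> ].
Qed.

Lemma psd_herm K s t : psd K -> K s t = conjC (K t s).
Proof.
move=> K0; have := @psd_two _ s t 1 1 K0; have := @psd_two _ s t 1 'i%C K0.
have [-> _] := psd_diag s K0; have [-> _] := psd_diag t K0.
case: (K s t) (K t s) => [a b] [c d]; rewrite !lecE /= => /andP[/eqP H _] /andP[/eqP H' _].
by congr Complex; lra.
Qed.

(** Each of the three test vectors settles one case: both diagonal values vanish,
    K t t is positive, or K s s is positive. *)
Lemma psd_CS K s t : psd K ->
  sqn (K s t) <= complex.Re (K s s) * complex.Re (K t t).
Proof.
move=> K0; have [] := (psd_diag s K0, psd_diag t K0).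
have := @psd_two _ s t (K s t) (- complex.Re (K s s))%:C%C K0.
have := @psd_two _ s t ((complex.Re (K t t))%:C%C) (- K t s) K0.
have := @psd_two _ s t (K s t) (- 1) K0.
rewrite (psd_herm t s K0); move: (K s s) (K t t) (K s t) => [a a'] [d d'] [b b'] /=.
move=> + + + [/(congr1 (@complex.Im R))/= a'0 a0] [/(congr1 (@complex.Im R))/= d'0 d0].
rewrite a'0 d'0 !lecE /sqn /= => /andP[_ H1] /andP[_ H2] /andP[_ H3].
have [a_eq0|a_neq0] := eqVneq a 0.
  have [d_eq0|d_neq0] := eqVneq d 0; first by subst; lra.
  have dp : 0 < d by rewrite lt_def d_neq0.
  rewrite -(ler_pM2l dp); subst; lra.
have ap : 0 < a by rewrite lt_def a_neq0.
rewrite -(ler_pM2l ap); lra.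
Qed.

(** Schur complement of the pivot u; division by zero being zero, it is K itself
    when K u u vanishes. *)
Definition schur K u s t : R[i] := K s t - K s u * K u t / K u u.

Lemma schur_psd K u : psd K -> psd (schur K u).
Proof.
move=> K0; have [u0|u0] := eqVneq (K u u) 0.
  rewrite (_ : schur K u = K)//; apply/funext => s; apply/funext => t.
  by rewrite /schur u0 invr0 mulr0 subr0.
(* The quadratic form of the complement at c is the form of K at the points s and u,
   where u gets the coefficient - b / K u u, which minimizes that form. *)
move=> n s c; pose b := \sum_j c j * K u (s j).
pose s' (i : 'I_n.+1) := oapp s u (unlift ord0 i).
pose c' (i : 'I_n.+1) := oapp c (- b / K u u) (unlift ord0 i).
have bE : conjC b = \sum_i conjC (c i) * K (s i) u.
  by rewrite rmorph_sum; apply: eq_bigr => i _; rewrite rmorphM/= -psd_herm.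
have kE : conjC (K u u) = K u u by rewrite -psd_herm.
have -> : \sum_i \sum_j conjC (c i) * c j * schur K u (s i) (s j) =
    \sum_i \sum_j conjC (c' i) * c' j * K (s' i) (s' j); last exact: K0.
rewrite [RHS]big_ord_recl big_ord_recl /s' /c' unlift_none /=.
under [in RHS]eq_bigr do rewrite liftK/=.
under [X in _ = _ + X]eq_bigr do rewrite big_ord_recl unlift_none liftK/=.
under [X in _ = _ + X]eq_bigr => i _.
  under eq_bigr do rewrite liftK/=.
  over.
have -> : \sum_i conjC (- b / K u u) * c i * K u (s i) = conjC (- b / K u u) * b.
  by rewrite /b big_distrr/=; apply: eq_bigr => i _; rewrite mulrA.
rewrite big_split/=.
have -> : \sum_i conjC (c i) * (- b / K u u) * K (s i) u = (- b / K u u) * conjC b.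
  by rewrite bE big_distrr/=; apply: eq_bigr => i _; ring.
have -> : \sum_i \sum_j conjC (c i) * c j * schur K u (s i) (s j) =
    \sum_i \sum_j conjC (c i) * c j * K (s i) (s j) - conjC b * b / K u u.
  rewrite bE /b big_distrlr/= big_distrl/= -sumrB; apply: eq_bigr => i _.
  rewrite big_distrl/= -sumrB; apply: eq_bigr => j _.
  by rewrite /schur; ring.
rewrite rmorphM/= rmorphN fmorphV/= kE; field.
exact: u0.
Qed.

(** Squared distance between the feature vectors of s and t. *)
Definition dist2 K s t : R := complex.Re (K s s - K s t - K t s + K t t).

(** A pivot splits off the component of the features along u, and orthogonal
    projections do not increase distances. *)
Lemma schur_dist2 K u s t : psd K -> dist2 (schur K u) s t <= dist2 K s t.
Proof.
move=> K0; rewrite -subr_ge0.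
have -> : dist2 K s t - dist2 (schur K u) s t = sqn (K s u - K t u) / complex.Re (K u u).
  rewrite /dist2 -raddfB/=.
  have -> : K s s - K s t - K t s + K t t -
      (schur K u s s - schur K u s t - schur K u t s + schur K u t t) =
      (K s u - K t u) * conjC (K s u - K t u) / K u u.
    by rewrite /schur rmorphB/= -!psd_herm//; ring.
  have [-> _] := psd_diag u K0.
  by rewrite mulCJ -fmorphV -rmorphM.
by rewrite divr_ge0 ?sqn_ge0//; have [] := psd_diag u K0.
Qed.

Lemma schur_diag_le K u s : psd K ->
  complex.Re (schur K u s s) <= complex.Re (K s s).
Proof.
move=> K0; rewrite /schur raddfB/= gerBl (psd_herm u s K0) mulCJ.
have [-> u0] := psd_diag u K0.
by rewrite -fmorphV -rmorphM/= divr_ge0 ?sqn_ge0.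
Qed.

Lemma schur_pivot K u : schur K u u u = 0.
Proof.
rewrite /schur; have [->|u0] := eqVneq (K u u) 0; first by rewrite !mul0r subr0.
by rewrite mulfK// subrr.
Qed.

Section kolmogorov.
Variables (K : S -> S -> R[i]) (p : nat -> S).
Hypothesis K_psd : psd K.

(** Cholesky factorization of K with pivots p 0, p 1 and so on, which amounts to the
    Gram-Schmidt process for the feature vectors. *)
Fixpoint residual (n : nat) : S -> S -> R[i] :=
  if n is m.+1 then schur (residual m) (p m) else K.

Definition pivot_coord (s : S) (n : nat) : R[i]^o :=
  residual n s (p n) / (Num.sqrt (complex.Re (residual n (p n) (p n))))%:C%C.

Lemma residual_psd n : psd (residual n).
Proof. by elim: n => [|n IH]//=; exact: schur_psd. Qed.

Lemma pivot_coord_sum s t N :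
  \sum_(0 <= n < N) (pivot_coord s n : R[i]) * conjC (pivot_coord t n : R[i])
  = K s t - residual N s t.
Proof.
elim: N => [|N IH]; first by rewrite big_nil subrr.
rewrite big_nat_recr//= IH /schur /pivot_coord.
set k := residual N; have k0 : psd k by exact: residual_psd.
have [kp kp0] := psd_diag (p N) k0; set r := Num.sqrt _.
have -> : k (p N) (p N) = r%:C%C * r%:C%C.
  by rewrite kp -rmorphM/= -expr2 sqr_sqrtr.
have -> : conjC (k t (p N) / r%:C%C) = k (p N) t / r%:C%C.
  by rewrite rmorphM/= fmorphV/= -psd_herm//; congr (_ / _); rewrite conjCE conjc_real.
by rewrite invfM; ring.
Qed.

Lemma residual_diag_le n m s : (n <= m)%N ->
  complex.Re (residual m s s) <= complex.Re (residual n s s).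
Proof.
elim: m => [|m IH]; first by rewrite leqn0 => /eqP ->.
rewrite leq_eqVlt => /orP[/eqP -> //|]; rewrite ltnS => /IH; apply: le_trans.
exact: schur_diag_le (residual_psd m).
Qed.

(** From step n + 1 on, the residual vanishes at p n, so its value on the diagonal at s
    is its squared distance from s to p n, and this distance has not grown. *)
Lemma residual_le_dist2 n m s : (n < m)%N ->
  complex.Re (residual m s s) <= dist2 K s (p n).
Proof.
move=> nm; apply: (@le_trans _ _ (dist2 (residual m) s (p n))); last first.
  elim: m {nm} => [|m IH] //=; exact: le_trans (schur_dist2 _ _ _ (residual_psd m)) IH.
have m0 := residual_psd m.
have [pp pp0] := psd_diag (p n) m0.
have pn : complex.Re (residual m (p n) (p n)) = 0.
  apply/eqP; rewrite eq_le pp0 andbT.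
  by apply: le_trans (residual_diag_le _ nm) _; rewrite /= schur_pivot.
have := psd_CS s (p n) m0; rewrite pn mulr0 => sp.
have sp0 : residual m s (p n) = 0.
  move: sp; case: (residual m s (p n)) => a b; rewrite /sqn /= => H.
  have a0 : a = 0 by nra.
  have b0 : b = 0 by nra.
  by rewrite a0 b0.
by rewrite /dist2 pp pn (psd_herm (p n) s m0) sp0 rmorph0 !subr0 addr0.
Qed.

Lemma pivot_coord_l2 s : pivot_coord s \in @l2pred R.
Proof.
apply/asboolP; exists (complex.Re (K s s)) => N.
have := congr1 (@complex.Re R) (pivot_coord_sum s s N).
rewrite raddf_sum raddfB/=.
under eq_bigr do rewrite mulCJ/=.
by move=> ->; rewrite gerBl; have [] := psd_diag s (residual_psd N).
Qed.

Definition feature s : l2 R := L2 (pivot_coord_l2 s).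

(** The residuals tend to zero when the pivots are dense. This realizes K as a Gram
    kernel in a concrete Hilbert space. *)
Lemma feature_dot s t :
  (forall u e, 0 < e -> exists n, dist2 K u (p n) < e) ->
  l2dot (feature s) (feature t) = K s t.
Proof.
move=> dense; apply: (ccvg_unique (l2dotP _ _)).
apply: ccvg_sqn => e e0.
have [T0 T1] := psd_diag t K_psd.
set T := complex.Re (K t t) in T0 T1.
have [n nse] := dense s (e / (T + 1)) (divr_gt0 e0 (ltr_wpDl T1 ltr01)).
exists n.+1 => N nN.
rewrite /l2psum [X in X - _](pivot_coord_sum s t N).
have -> : K s t - residual N s t - K s t = - residual N s t by ring.
have -> (z : R[i]) : sqn (- z) = sqn z by case: z => a b; rewrite /sqn /=; ring.
apply: le_lt_trans (psd_CS s t (residual_psd N)) _.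
have [_ s0] := psd_diag s (residual_psd N).
have [_ t0] := psd_diag t (residual_psd N).
have sn := le_lt_trans (residual_le_dist2 s nN) nse.
have tT := @residual_diag_le 0 N t (leq0n _).
apply: (@le_lt_trans _ _ (complex.Re (residual N s s) * (T + 1))).
  by rewrite ler_wpM2l// (le_trans tT)// lerDl.
by rewrite -ltr_pdivlMr// ltr_wpDl.
Qed.

End kolmogorov.
End psd_kernel.

Lemma psd_fin (R : realType) (S : Type) (K : S -> S -> R[i]) (I : finType)
    (s : I -> S) (c : I -> R[i]) : psd K ->
  0 <= \sum_i \sum_j conjC (c i) * c j * K (s i) (s j).
Proof.
move=> /(_ #|I| (s \o enum_val) (c \o enum_val)); congr (_ <= _).
rewrite [RHS](reindex _ (onW_bij _ (enum_val_bij _)))/=; apply: eq_bigr => i _.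
by rewrite [RHS](reindex _ (onW_bij _ (enum_val_bij _))).
Qed.

(** * Integration of bounded complex functions *)

Definition cabs (R : realType) (z : R[i]) : R := Num.sqrt (sqn z).

Section cabs.
Variable R : realType.
Implicit Types z w : R[i].

Lemma cabsE z : (cabs z)%:C%C = `|z|.
Proof. by rewrite normc_def. Qed.

Lemma cabs_ge0 z : 0 <= cabs z. Proof. exact: sqrtr_ge0. Qed.

Lemma cabsM z w : cabs (z * w) = cabs z * cabs w.
Proof. by rewrite /cabs sqnM sqrtrM// sqn_ge0. Qed.

Lemma cabsD z w : cabs (z + w) <= cabs z + cabs w.
Proof. by rewrite -lecR rmorphD/= !cabsE; exact: ler_normD. Qed.

Lemma cabsN z : cabs (- z) = cabs z.
Proof. by apply: complexI; rewrite !cabsE normrN. Qed.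

Lemma cabsB z w : cabs (z - w) <= cabs z + cabs w.
Proof. by rewrite (le_trans (cabsD _ _))// cabsN. Qed.

Lemma cabs_real (a : R) : cabs a%:C%C = `|a|.
Proof. by rewrite /cabs /sqn /= expr0n addr0 sqrtr_sqr. Qed.

Lemma cabs0 : cabs (0 : R[i]) = 0.
Proof. by rewrite -(rmorph0 (real_complex R)) cabs_real normr0. Qed.

Lemma normr_Re_le z : `|complex.Re z| <= cabs z.
Proof.
case: z => a b /=; rewrite -sqrtr_sqr /cabs ler_wsqrtr//.
by rewrite /sqn /= lerDl sqr_ge0.
Qed.

Lemma normr_Im_le z : `|complex.Im z| <= cabs z.
Proof.
case: z => a b /=; rewrite -sqrtr_sqr /cabs ler_wsqrtr//.
by rewrite /sqn /= lerDr sqr_ge0.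
Qed.

Lemma cabs_le z : cabs z <= `|complex.Re z| + `|complex.Im z|.
Proof.
case: z => a b /=.
have -> : (a +i* b = a%:C + 'i * b%:C)%C by rewrite {1}(complexE (a +i* b)%C).
rewrite (le_trans (cabsD _ _))// cabsM !cabs_real.
by rewrite /cabs /sqn /= expr0n expr1n add0r sqrtr1 mul1r.
Qed.

Lemma cabs_eq0 z : cabs z = 0 -> z = 0.
Proof. by move=> z0; apply: normr0_eq0; rewrite -cabsE z0. Qed.

End cabs.

(** Measurability is asked of the real and imaginary parts, because these are what
    gets integrated. *)
Definition bounded_meas (R : realType) d (T : measurableType d) (f : T -> R[i]) :=
  [/\ measurable_fun setT (fun x => complex.Re (f x)),
      measurable_fun setT (fun x => complex.Im (f x)) &
      exists M : R, forall x, cabs (f x) <= M].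

Section bounded_meas.
Context (R : realType) d (T : measurableType d).
Implicit Types f g : T -> R[i].

Lemma bounded_meas_cst (a : R[i]) : bounded_meas (fun _ : T => a).
Proof. by split; [exact: measurable_cst|exact: measurable_cst|exists (cabs a)]. Qed.

Lemma bounded_measD f g : bounded_meas f -> bounded_meas g ->
  bounded_meas (fun x => f x + g x).
Proof.
move=> [fr fi [M fM]] [gr gi [M' gM]]; split.
- by under eq_fun do rewrite raddfD/=; exact: measurable_funD.
- by under eq_fun do rewrite raddfD/=; exact: measurable_funD.
- by exists (M + M') => x; rewrite (le_trans (cabsD _ _))// lerD.
Qed.

Lemma bounded_measM f g : bounded_meas f -> bounded_meas g ->
  bounded_meas (fun x => f x * g x).
Proof.
move=> [fr fi [M fM]] [gr gi [M' gM]]; split.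
- by under eq_fun do rewrite ReM; apply: measurable_funB; exact: measurable_funM.
- by under eq_fun do rewrite ImM; apply: measurable_funD; exact: measurable_funM.
- by exists (M * M') => x; rewrite cabsM ler_pM ?cabs_ge0.
Qed.

Lemma bounded_meas_sum n (F : 'I_n -> T -> R[i]) :
  (forall i, bounded_meas (F i)) -> bounded_meas (fun x => \sum_i F i x).
Proof.
elim: n F => [F _|n IH F H].
  by under eq_fun do rewrite big_ord0; exact: bounded_meas_cst.
under eq_fun do rewrite big_ord_recr/=.
by apply: bounded_measD => //; apply: IH => i.
Qed.

Lemma bounded_measZ (a : R[i]) f : bounded_meas f -> bounded_meas (fun x => a * f x).
Proof. by move=> bf; apply: bounded_measM => //; exact: bounded_meas_cst. Qed.

Lemma bounded_measB f g : bounded_meas f -> bounded_meas g ->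
  bounded_meas (fun x => f x - g x).
Proof.
move=> bf bg; under eq_fun do rewrite -mulN1r.
by apply: bounded_measD => //; exact: bounded_measZ.
Qed.

Lemma bounded_meas_comp d' (T' : measurableType d') (h : T' -> T) f :
  measurable_fun setT h -> bounded_meas f -> bounded_meas (fun x => f (h x)).
Proof.
move=> mh [fr fi [M fM]]; split; last by exists M.
- exact: measurableT_comp fr mh.
- exact: measurableT_comp fi mh.
Qed.

Lemma measurable_cabs f : bounded_meas f -> measurable_fun setT (fun x => cabs (f x)).
Proof.
move=> [fr fi _]; have mq : measurable_fun setT (@Num.sqrt R).
  exact: continuous_measurable_fun (@sqrt_continuous R).
rewrite (_ : (fun x => _) = Num.sqrt \o (fun x => sqn (f x)))//.
apply: (measurableT_comp mq).
by apply: measurable_funD; exact: measurable_funX.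
Qed.

End bounded_meas.

Definition cint (R : realType) d (T : measurableType d) (P : probability T R) (f : T -> R[i]) : R[i] :=
  Complex (\int[P]_x complex.Re (f x)) (\int[P]_x complex.Im (f x)).

Section cint.
Context (R : realType) d (T : measurableType d) (P : probability T R).
Implicit Types f g : T -> R[i].

Lemma bounded_integrable (f : T -> R) (M : R) :
  measurable_fun setT f -> (forall x, `|f x| <= M) -> P.-integrable setT (EFin \o f).
Proof.
move=> mf fM; apply: measurable_bounded_integrable => //.
  exact: fin_num_fun_lty.
by exists M; split; [exact: num_real|move=> N MN x _; exact: le_trans (fM x) (ltW MN)].
Qed.

Lemma integrable_Re f : bounded_meas f -> P.-integrable setT (EFin \o (fun x => complex.Re (f x))).
Proof.
by move=> [fr _ [M fM]]; apply: (@bounded_integrable _ M) => // x; exact: le_trans (normr_Re_le _) (fM x).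
Qed.

Lemma integrable_Im f : bounded_meas f -> P.-integrable setT (EFin \o (fun x => complex.Im (f x))).
Proof.
by move=> [_ fi [M fM]]; apply: (@bounded_integrable _ M) => // x; exact: le_trans (normr_Im_le _) (fM x).
Qed.

Lemma cintD f g : bounded_meas f -> bounded_meas g ->
  cint P (fun x => f x + g x) = cint P f + cint P g.
Proof.
move=> bf bg; rewrite /cint.
under eq_Rintegral do rewrite raddfD/=.
under [X in Complex _ X]eq_Rintegral do rewrite raddfD/=.
rewrite !RintegralD//; [exact: integrable_Im|exact: integrable_Im|exact: integrable_Re|exact: integrable_Re].
Qed.

Lemma cintZ a f : bounded_meas f -> cint P (fun x => a * f x) = a * cint P f.
Proof.
move=> bf; rewrite /cint.
under eq_Rintegral do rewrite ReM.
under [X in Complex _ X]eq_Rintegral do rewrite ImM.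
have [fr fi _] := bf.
have iR := integrable_Re bf; have iI := integrable_Im bf.
have iZ (r : R) (h : T -> R) :
    P.-integrable setT (EFin \o h) -> P.-integrable setT (EFin \o (fun x => r * h x)).
  move=> ih; have := integrableZl measurableT r ih; congr (_.-integrable _ _).
rewrite RintegralB ?RintegralD ?RintegralZl//; try exact: iZ.
by case: a.
Qed.

Lemma Rintegral_cst_probability (r : R) : \int[P]_x r = r.
Proof.
rewrite /Rintegral integral_cst//.
transitivity (fine (r%:E * 1)%E); last by rewrite mule1.
by congr (fine (_ * _)%E); exact: probability_setT.
Qed.

Lemma cint_cst a : cint P (fun=> a) = a.
Proof.
case: a => a b; rewrite /cint /=.
by rewrite !Rintegral_cst_probability.
Qed.

Lemma cint_sum n (F : 'I_n -> T -> R[i]) : (forall i, bounded_meas (F i)) ->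
  cint P (fun x => \sum_i F i x) = \sum_i cint P (F i).
Proof.
elim: n F => [F _|n IH F H].
  by under eq_fun do rewrite big_ord0; rewrite cint_cst big_ord0.
under eq_fun do rewrite big_ord_recr/=.
rewrite cintD// ?IH ?big_ord_recr//.
exact: bounded_meas_sum.
Qed.

Lemma cint_ge0 f : (forall x, 0 <= f x) -> 0 <= cint P f.
Proof.
move=> f0; rewrite lecE /=; apply/andP; split.
  apply/eqP; rewrite -[RHS]Rintegral_cst_probability.
  by apply: eq_Rintegral => x _; have := f0 x; rewrite lecE /= => /andP[/eqP ->].
by apply: Rintegral_ge0 => x _; have := f0 x; rewrite lecE => /andP[_].
Qed.

(** The factor 2 comes from bounding the real and imaginary parts separately; it only
    affects the constants of weak amenability and of the weak Haagerup property. *)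
Lemma cabs_cint_le_int f : bounded_meas f ->
  cabs (cint P f) <= 2 * \int[P]_x cabs (f x).
Proof.
move=> bf; apply: (le_trans (cabs_le _)); rewrite /cint/=.
have [fr fi [M fM]] := bf.
have iA : P.-integrable setT (EFin \o (fun x => cabs (f x))).
  apply: (@bounded_integrable _ M); first exact: measurable_cabs.
  by move=> x; rewrite ger0_norm ?cabs_ge0.
rewrite mulr_natl mulr2n; apply: lerD.
  apply: (le_trans (le_normr_Rintegral _ _)) => //; first exact: integrable_Re.
  apply: le_Rintegral => //; last by move=> x _; exact: normr_Re_le.
  exact: integrable_norm (integrable_Re bf).
apply: (le_trans (le_normr_Rintegral _ _)) => //; first exact: integrable_Im.
apply: le_Rintegral => //; last by move=> x _; exact: normr_Im_le.
exact: integrable_norm (integrable_Im bf).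
Qed.

Lemma cabs_cint_le f M : bounded_meas f -> (forall x, cabs (f x) <= M) ->
  cabs (cint P f) <= 2 * M.
Proof.
move=> bf fM; apply: (le_trans (cabs_cint_le_int bf)); rewrite ler_pM2l//.
have -> : M = \int[P]_(x in setT) M by rewrite Rintegral_cst_probability.
apply: le_Rintegral => //.
  apply: (@bounded_integrable _ M); first exact: measurable_cabs.
  by move=> x; rewrite ger0_norm ?cabs_ge0.
by apply: (@bounded_integrable _ `|M|).
Qed.

Lemma cint_ae f g : bounded_meas f -> bounded_meas g ->
  (\forall x \ae P, f x = g x) -> cint P f = cint P g.
Proof.
move=> [fr fi _] [gr gi _] fg; rewrite /cint /Rintegral; congr (Complex (fine _) (fine _)).
  apply: ae_eq_integral => //; [exact/measurable_EFinP|exact/measurable_EFinP|].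
  by apply: filterS fg => x /= -> _.
apply: ae_eq_integral => //; [exact/measurable_EFinP|exact/measurable_EFinP|].
by apply: filterS fg => x /= -> _.
Qed.

Lemma cint_invariant (h : T -> T) f : measurable_fun setT h ->
  (forall A, measurable A -> P (h @^-1` A) = P A) ->
  bounded_meas f -> cint P (fun x => f (h x)) = cint P f.
Proof.
move=> mh Ph bf.
have E (g : T -> R) : measurable_fun setT g -> P.-integrable setT (EFin \o (g \o h)) ->
    \int[P]_x g (h x) = \int[P]_x g x.
  move=> mg ig; rewrite /Rintegral; congr fine.
  have := @integral_pushforward _ _ _ _ _ _ mh P setT (EFin \o g) _ ig measurableT.
  rewrite preimage_setT => <-; last exact/measurable_EFinP.
  by apply: eq_measure_integral => A mA _; exact: Ph.
have [fr fi _] := bf; have bfh := bounded_meas_comp mh bf.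
rewrite /cint (E (fun x => complex.Re (f x)) fr (integrable_Re bfh)).
by rewrite (E (fun x => complex.Im (f x)) fi (integrable_Im bfh)).
Qed.

Lemma cint_cvg (f_ : nat -> T -> R[i]) (l : R[i]) (M : R) :
  (forall n, bounded_meas (f_ n)) -> (forall n x, cabs (f_ n x) <= M) ->
  (\forall x \ae P, (fun n => cabs (f_ n x - l)) @ \oo --> (0 : R)) ->
  (fun n => cabs (cint P (f_ n) - l)) @ \oo --> (0 : R).
Proof.
move=> bf fM fl.
have bg n : bounded_meas (fun x => f_ n x - l).
  by apply: bounded_measB => //; exact: bounded_meas_cst.
have gM n x : cabs (f_ n x - l) <= M + cabs l.
  by rewrite (le_trans (cabsB _ _))// lerD2r.
have E n : cint P (f_ n) - l = cint P (fun x => f_ n x - l).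
  under [in RHS]eq_fun do rewrite -[in X in _ + X](mul1r l) -mulNr.
  rewrite cintD//; [|exact: bounded_measZ (bounded_meas_cst _ _)].
  by rewrite cintZ ?cint_cst ?mulN1r//; exact: bounded_meas_cst.
have [|||||_ _ H] := @dominated_convergence _ T R P setT measurableT
    (fun n x => (cabs (f_ n x - l))%:E) (cst 0%E) (cst (M + cabs l)%:E).
- by move=> n; apply/measurable_EFinP/measurable_cabs.
- by [].
- by apply: filterS fl => x /= H _; apply: cvg_EFin => //; exact: nearW.
- by apply: finite_measure_integrable_cst.
- by apply: aeW => x n _; rewrite /= lee_fin ger0_norm ?cabs_ge0.
rewrite integral0 in H.
have H' : (fun n => 2 * \int[P]_x cabs (f_ n x - l)) @ \oo --> (0 : R).
  rewrite -(mulr0 (2 : R)); apply: cvgMr.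
  exact: (fine_cvg H).
apply: (@squeeze_cvgr _ _ _ _ (cst 0) (fun n => 2 * \int[P]_x cabs (f_ n x - l))) => //; last exact: cvg_cst.
by apply: nearW => n; rewrite cabs_ge0 E /= cabs_cint_le_int.
Qed.

End cint.

Section cint_prod.
Context (R : realType) d1 d2 (T1 : measurableType d1) (T2 : measurableType d2)
  (P : probability T1 R) (Q : probability T2 R).
Variable f : T1 * T2 -> R[i].
Hypothesis bf : bounded_meas f.

Lemma bounded_meas_section1 x : bounded_meas (fun y => f (x, y)).
Proof. exact: bounded_meas_comp (measurable_pair1 x) bf. Qed.

Lemma bounded_meas_section2 y : bounded_meas (fun x => f (x, y)).
Proof. exact: bounded_meas_comp (measurable_pair2 y) bf. Qed.

Lemma bounded_meas_cint : bounded_meas (fun x => cint Q (fun y => f (x, y))).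
Proof.
have [fr fi [M fM]] := bf; split.
- have := measurable_fubini_F (integrable_Re (P \x Q)%E bf).
  by move=> H; apply: measurableT_comp H.
- have := measurable_fubini_F (integrable_Im (P \x Q)%E bf).
  by move=> H; apply: measurableT_comp H.
- by exists (2 * M) => x; apply: cabs_cint_le => //; exact: bounded_meas_section1.
Qed.

Lemma cint_prod1 : cint P (fun x => cint Q (fun y => f (x, y))) = cint (P \x Q)%E f.
Proof.
have iR := integrable_Re (P \x Q)%E bf; have iI := integrable_Im (P \x Q)%E bf.
rewrite /cint /Rintegral /=; congr Complex.
  rewrite -(integral12_prod_meas1 iR); congr fine; apply: eq_integral => x _ /=.
  rewrite fineK//; apply: integrable_fin_num => //.
  exact: (integrable_Re Q (bounded_meas_section1 x)).
rewrite -(integral12_prod_meas1 iI); congr fine; apply: eq_integral => x _ /=.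
rewrite fineK//; apply: integrable_fin_num => //.
exact: (integrable_Im Q (bounded_meas_section1 x)).
Qed.

Lemma cint_prod2 : cint Q (fun y => cint P (fun x => f (x, y))) = cint (P \x Q)%E f.
Proof.
have iR := integrable_Re (P \x Q)%E bf; have iI := integrable_Im (P \x Q)%E bf.
rewrite /cint /Rintegral /=; congr Complex.
  rewrite -(integral21_prod_meas1 iR); congr fine; apply: eq_integral => x _ /=.
  rewrite fineK//; apply: integrable_fin_num => //.
  exact: (integrable_Re P (bounded_meas_section2 x)).
rewrite -(integral21_prod_meas1 iI); congr fine; apply: eq_integral => x _ /=.
rewrite fineK//; apply: integrable_fin_num => //.
exact: (integrable_Im P (bounded_meas_section2 x)).
Qed.

End cint_prod.

(** The left-hand side is 1 / 2^n times the expected sum of K over all pairs from 2^n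
    independent points. The induction step passes to pairs of points and to the kernel
    K2 summing K over both coordinates. *)
Lemma cint_psd_doubling (R : realType) n d (T : measurableType d) (P : probability T R)
    (K : T -> T -> R[i]) : psd K -> bounded_meas (fun p => K p.1 p.2) ->
  0 <= cint P (fun s => K s s) + (2 ^ n).-1%:R * cint P (fun s => cint P (K s)).
Proof.
elim: n d T P K => [|n IH] d T P K Kpsd Kb.
  rewrite mul0r addr0; apply: cint_ge0 => s.
  by have [-> ?] := psd_diag s Kpsd; rewrite ler0c.
pose K2 (p q : T * T) := K p.1 q.1 + K p.1 q.2 + (K p.2 q.1 + K p.2 q.2).
have bK d' (T' : measurableType d') (u v : T' -> T) : measurable_fun setT u ->
    measurable_fun setT v -> bounded_meas (fun x => K (u x) (v x)).
  move=> mu mv; apply: (bounded_meas_comp (h := fun x => (u x, v x)) _ Kb).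
  exact: measurable_fun_pair.
have K2psd : psd K2.
  move=> m s c.
  have := psd_fin (fun p : 'I_m * bool => if p.2 then (s p.1).1 else (s p.1).2)
    (fun p => c p.1) Kpsd.
  rewrite -(pair_bigA _ (fun i a => \sum_(q : 'I_m * bool) conjC (c i) * c q.1 *
    K (if a then (s i).1 else (s i).2) (if q.2 then (s q.1).1 else (s q.1).2)))/=.
  congr (_ <= _); apply: eq_bigr => i _; rewrite big_bool/=.
  rewrite -(pair_bigA _ (fun j a => conjC (c i) * c j * K (s i).1 (if a then (s j).1 else (s j).2)))/=.
  rewrite -(pair_bigA _ (fun j a => conjC (c i) * c j * K (s i).2 (if a then (s j).1 else (s j).2)))/=.
  rewrite -big_split/=; apply: eq_bigr => j _; rewrite !big_bool/= /K2; ring.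
have K2b : bounded_meas (fun p : (T * T) * (T * T) => K2 p.1 p.2).
  have m1 := @measurable_fst _ _ (T * T)%type (T * T)%type.
  have m2 := @measurable_snd _ _ (T * T)%type (T * T)%type.
  have m11 := measurableT_comp (@measurable_fst _ _ T T) m1.
  have m12 := measurableT_comp (@measurable_snd _ _ T T) m1.
  have m21 := measurableT_comp (@measurable_fst _ _ T T) m2.
  have m22 := measurableT_comp (@measurable_snd _ _ T T) m2.
  apply: bounded_measD; apply: bounded_measD.
  - exact: (bK _ _ _ _ m11 m21).
  - exact: (bK _ _ _ _ m11 m22).
  - exact: (bK _ _ _ _ m12 m21).
  - exact: (bK _ _ _ _ m12 m22).
have := IH _ _ (P \x P)%E K2 K2psd K2b.
pose I := cint P (fun s => cint P (K s)); pose D := cint P (fun s => K s s).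
have c1 (f : T -> R[i]) : bounded_meas f -> cint (P \x P)%E (fun p => f p.1) = cint P f.
  move=> bf; rewrite -(cint_prod1 P P (f := fun p => f p.1)).
    congr (cint P _); apply/funext => s /=; exact: cint_cst.
  exact: (bounded_meas_comp measurable_fst bf).
have c2 (f : T -> R[i]) : bounded_meas f -> cint (P \x P)%E (fun p => f p.2) = cint P f.
  move=> bf; rewrite -(cint_prod1 P P (f := fun p => f p.2)) /=.
    by exact: cint_cst.
  exact: (bounded_meas_comp measurable_snd bf).
have m1 := @measurable_fst _ _ T T.
have m2 := @measurable_snd _ _ T T.
have DE : cint (P \x P)%E (fun p => K2 p p) = D + D + (I + I).
  have b11 := bK _ _ _ _ m1 m1; have b12 := bK _ _ _ _ m1 m2.
  have b21 := bK _ _ _ _ m2 m1; have b22 := bK _ _ _ _ m2 m2.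
  rewrite /K2 !cintD//=; [|exact: bounded_measD|exact: bounded_measD].
  rewrite (c1 (fun s => K s s)) ?(c2 (fun s => K s s)); try exact: bK.
  rewrite -(cint_prod1 P P (f := fun p => K p.1 p.2)) 
    -?(cint_prod2 P P (f := fun p => K p.2 p.1)) /=; try exact: bK.
  by rewrite /D /I; ring.
have A : bounded_meas (fun s => cint P (K s)).
  exact: (bounded_meas_cint P P Kb).
have IE : cint (P \x P)%E (fun p => cint (P \x P)%E (K2 p)) = 4 * I.
  have -> : (fun p => cint (P \x P)%E (K2 p)) = fun p => 2 * cint P (K p.1) + 2 * cint P (K p.2).
    apply/funext => -[s t]; rewrite /K2 /=.
    have b1 := bounded_meas_section1 Kb s; have b2 := bounded_meas_section1 Kb t.
    rewrite !cintD/=; try by repeat apply: bounded_measD; apply: bK => //.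
    by rewrite (c1 (K s)) ?(c2 (K s)) ?(c1 (K t)) ?(c2 (K t))//; ring.
  have A1 : bounded_meas (fun x : T * T => cint P (K x.1)) := bounded_meas_comp m1 A.
  have A2 : bounded_meas (fun x : T * T => cint P (K x.2)) := bounded_meas_comp m2 A.
  rewrite (cintD _ (bounded_measZ 2 A1) (bounded_measZ 2 A2)) (cintZ _ 2 A1) (cintZ _ 2 A2).
  by rewrite (c1 _ A) (c2 _ A) /I; ring.
rewrite DE IE => H.
have -> : D + (2 ^ n.+1).-1%:R * I = (D + D + (I + I) + (2 ^ n).-1%:R * (4 * I)) / 2.
  have -> : (2 ^ n.+1).-1%:R = 2 * (2 ^ n).-1%:R + 1 :> R[i].
    rewrite -natrM natr1; congr (_%:R); rewrite expnS.
    have : (0 < 2 ^ n)%N by rewrite expn_gt0.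
    by case: (2 ^ n)%N => // m _; rewrite mulnS.
  by field.
by rewrite divr_ge0.
Qed.

(** A negative double integral would dominate the diagonal term for a large number of
    sample points. *)
Lemma cint_psd (R : realType) d (T : measurableType d) (P : probability T R)
    (K : T -> T -> R[i]) : psd K -> bounded_meas (fun p => K p.1 p.2) ->
  0 <= cint P (fun s => cint P (K s)).
Proof.
move=> Kpsd Kb; have H := fun n => cint_psd_doubling n P Kpsd Kb.
have := H 0; rewrite mul0r addr0.
move: H; move: (cint P (fun s => K s s)) (cint P (fun s => cint P (K s))) => [a b] [c d'] H.
rewrite lecE /= => /andP[/eqP b0 a0].
have {}H n : d' * (2 ^ n).-1%:R = 0 /\ 0 <= a + c * (2 ^ n).-1%:R.
  have := H n; rewrite (_ : (2 ^ n).-1%:R = ((2 ^ n).-1%:R : R)%:C%C); last by rewrite rmorph_nat.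
  by rewrite lecE /= b0 => /andP[/eqP e h]; split; lra.
rewrite lecE /=; apply/andP; split; first by have [] := H 1; rewrite mulr1 => ->.
rewrite leNgt; apply/negP => c0.
pose N := truncn (a / - c).
have Ngt : a / - c < N.+1%:R by exact: truncnS_gt.
have [_] := H N.+1.
have le : N.+1%:R <= (2 ^ N.+1).-1%:R :> R.
  by rewrite ler_nat -ltnS prednK ?expn_gt0// ltn_expl.
rewrite ltr_pdivrMr ?oppr_gt0// in Ngt.
move: le Ngt; move: (_.-1%:R) (_.+1%:R) => u v uv av.
nra.
Qed.

(** * Borel structure of locally compact second countable groups *)

Section borel_topology.
Variable T : ptopologicalType.

Lemma borel_open (A : set T) : open A -> measurable (A : set (borel T)).
Proof. exact: sub_sigma_algebra. Qed.

Lemma borel_closed (A : set T) : closed A -> measurable (A : set (borel T)).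
Proof.
move=> cA; rewrite -(setCK A); apply: measurableC.
by apply: borel_open; exact: closed_openC.
Qed.

Lemma borel_compact (A : set T) : hausdorff_space T -> compact A -> measurable (A : set (borel T)).
Proof. by move=> hT cA; apply: borel_closed; exact: compact_closed. Qed.

Lemma measurable_fun_borel d (X : measurableType d) (f : X -> borel T) :
  (forall U : set T, open U -> measurable (f @^-1` U)) -> measurable_fun setT f.
Proof.
move=> H; apply: (measurability (@open T : set (set (borel T)))) => [|_ [U oU <-]]; first exact: erefl.
by rewrite setTI; exact: H.
Qed.

Lemma second_countable_basis : @second_countable T ->
  exists b : nat -> set T, (forall n, open (b n)) /\
    forall x U, nbhs x U -> exists n, b n x /\ b n `<=` U.
Proof.
move=> [B /countable_injP[f finj] [oB bB]].
exists (fun n => \bigcup_(U in [set U | B U /\ f U = n]) U); split.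
  by move=> n; apply: bigcup_open => U [/oB].
move=> x U /bB[V [BV Vx] VU]; exists (f V); split; first by exists V.
move=> y [W [BW fW] Wy]; apply: VU.
by rewrite -(finj W V) ?inE.
Qed.

End borel_topology.

Lemma continuous_measurable_borel (T U : ptopologicalType) (f : T -> U) :
  continuous f -> measurable_fun setT (f : borel T -> borel U).
Proof.
move=> /continuousP cf; apply: measurable_fun_borel => V oV.
by apply: borel_open; exact: cf.
Qed.

Lemma borel_open_prod (T U : ptopologicalType) (W : set (T * U)) :
  @second_countable T -> @second_countable U ->
  open W -> measurable (W : set (borel T * borel U)).
Proof.
move=> /second_countable_basis[b [ob nb]] /second_countable_basis[c [oc nc]] oW.
have -> : W = \bigcup_n \bigcup_(m in [set m | b n `*` c m `<=` W]) (b n `*` c m).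
  apply/seteqP; split => [[x y] Wxy|p [n _ [m sW /sW]]//].
  have [[A B] /= [Ax By] ABW] : nbhs (x, y) W by exact: open_nbhs_nbhs.
  have [n [bnx bnA]] := nb _ _ Ax; have [m [cmy cmB]] := nc _ _ By.
  exists n => //; exists m => //= -[u v] [/= /bnA Au /cmB Bv]; exact: ABW.
apply: bigcup_measurable => n _; apply: bigcup_measurable => m _.
by apply: measurableX; exact: borel_open.
Qed.

Lemma continuous_measurable_borel2 (T U V : ptopologicalType) (f : T * U -> V) :
  @second_countable T -> @second_countable U -> continuous f ->
  measurable_fun setT (f : borel T * borel U -> borel V).
Proof.
move=> cT cU /continuousP cf; apply: measurable_fun_borel => W oW.
by apply: borel_open_prod => //; exact: cf.
Qed.

Lemma measurable_real_borel (R : realType) : measurable_fun setT (id : borel R -> R).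
Proof.
apply: (measurability _ (RGenOpens.measurableE R)) => _ [_ [a [b ->] <-]].
by rewrite setTI; apply: borel_open; exact: interval_open.
Qed.

Section lcsc_group.
Variable G : lcscGroupType.
Implicit Types (A B : set G) (g h : G).

Lemma continuousMg (T : topologicalType) (f k : T -> G) : continuous f -> continuous k ->
  continuous (fun x => (f x * k x)%g).
Proof.
move=> cf ck x.
apply: (@continuous_comp _ _ _ (fun x => (f x, k x)) (fun p : G * G => (p.1 * p.2)%g)).
  by apply: cvg_pair; [exact: cf|exact: ck].
exact: mulg_continuous.
Qed.

Lemma continuousVg (T : topologicalType) (f : T -> G) : continuous f ->
  continuous (fun x => (f x)^-1%g).
Proof.
move=> cf x; apply: (@continuous_comp _ _ _ f (fun y : G => y^-1%g)); first exact: cf.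
exact: invg_continuous.
Qed.

Lemma continuous_idg : continuous (fun x : G => x). Proof. by move=> x; exact. Qed.
Lemma continuous_cstg (T : topologicalType) g : continuous (fun _ : T => g).
Proof. by move=> x; exact: cvg_cst. Qed.

Lemma compact_mulg A B : compact A -> compact B ->
  compact [set (p.1 * p.2)%g | p in A `*` B].
Proof.
move=> cA cB; apply: continuous_compact; last exact: compact_setX.
by apply: continuous_subspaceT; exact: mulg_continuous.
Qed.

Lemma compact_invg A : compact A -> compact [set x^-1%g | x in A].
Proof.
by move=> cA; apply: continuous_compact => //; apply: continuous_subspaceT; exact: invg_continuous.
Qed.

(** The sets of a countable basis that lie in compact sets cover the group. *)
Lemma lcsc_exhaustion : exists Q : nat -> set G,
  [/\ forall n, compact (Q n), forall n m, (n <= m)%N -> Q n `<=` Q m &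
      forall x, exists n, Q n x].
Proof.
have [b [ob nb]] := second_countable_basis (@lcsc_second_countable G).
have /(_ _)/cid - C' n : exists C, compact C /\ ((exists K, compact K /\ b n `<=` K) -> b n `<=` C).
  have [[K [cK bK]]|H] := pselect (exists K, compact K /\ b n `<=` K).
    by exists K.
  by exists set0; split => //; exact: compact0.
pose C n := projT1 (C' n); have HC n := projT2 (C' n).
exists (fun n => \big[setU/set0]_(i < n.+1) C i); split.
- by move=> n; apply: bigsetU_compact => i _; have [] := HC i.
- by move=> n m nm; exact: subset_bigsetU.
- move=> x; have [A nA [cA _]] := @lcsc_locally_compact G x I.
  have nA' : nbhs x A by move: nA; rewrite /within/=; apply: filterS => y; exact.
  have [n [bnx bnA]] := nb _ _ nA'; exists n.
  rewrite -bigcup_mkord; exists n => //=.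
  by have [_] := HC n; apply => //; exists A.
Qed.

End lcsc_group.

(** * Null sets and Haar measure *)

Section fubini_null.
Context (R : realType) d1 d2 (T1 : measurableType d1) (T2 : measurableType d2).
Variables (m1 : {sigma_finite_measure set T1 -> \bar R}) (m2 : {sigma_finite_measure set T2 -> \bar R}).

Lemma null_xsection (N : set (T1 * T2)) : measurable N -> (m1 \x m2)%E N = 0%E ->
  \forall x \ae m1, m2 (xsection N x) = 0%E.
Proof.
move=> mN N0; have mx := measurable_fun_xsection m2 mN.
have /ae_eq_integral_abs : measurable_fun setT (m2 \o xsection N) by exact: mx.
move=> /(_ m1 measurableT)[+ _].
under eq_integral do rewrite gee0_abs ?measure_ge0//.
by move=> /(_ N0); apply: filterS => x /= /(_ I).
Qed.

Lemma prod_null_swap (N : set (T1 * T2)) : measurable N -> (m1 \x m2)%E N = 0%E ->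
  (\int[m2]_y m1 (ysection N y) = 0)%E.
Proof.
move=> mN <-; apply/esym.
rewrite (@product_measure_unique _ _ _ _ _ m1 m2 (m1 \x^ m2)%E)//.
by move=> A B mA mB; exact: product_measure2E.
Qed.

End fubini_null.

Section haar.
Context (R : realType) (G : lcscGroupType) (lam : {sigma_finite_measure set (borel G) -> \bar R}).
Hypothesis lam_haar : haar_measure lam.

Lemma measurable_mulgl (g : G) : measurable_fun setT ((fun k => (g * k)%g) : borel G -> borel G).
Proof.
by apply: continuous_measurable_borel; apply: continuousMg; [exact: continuous_cstg|exact: continuous_idg].
Qed.

Lemma measurable_invg : measurable_fun setT ((fun k => k^-1%g) : borel G -> borel G).
Proof. by apply: continuous_measurable_borel; apply: continuousVg; exact: continuous_idg. Qed.

Lemma haar_neq0 : lam setT != 0%E. Proof. by have [] := lam_haar. Qed.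

Lemma haar_compact (K : set G) : compact K -> (lam K < +oo)%E.
Proof. by have [_ + _] := lam_haar; exact. Qed.

Lemma haar_mulgl (g : G) (A : set (borel G)) : measurable A -> lam [set k | A (g * k)%g] = lam A.
Proof. by have [_ _] := lam_haar; exact. Qed.

Lemma measurable_compactg (K : set G) : compact K -> measurable (K : set (borel G)).
Proof. by apply: borel_compact; exact: lcsc_hausdorff. Qed.

(** Fubini for the set of pairs (x, y) with x^-1 * y in A, whose sections are translates
    of A and of its inverse. *)
Lemma haar_null_inv (A : set (borel G)) : measurable A -> lam A = 0%E ->
  lam [set k : borel G | A (k^-1%g : G)] = 0%E.
Proof.
move=> mA A0.
pose W : set (borel G * borel G) := [set p | A (((p.1 : G)^-1 * (p.2 : G))%g : G)].
have mW : measurable W.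
  rewrite -[W]setTI.
  suff : measurable_fun setT ((fun p : G * G => (p.1^-1 * p.2)%g) : borel G * borel G -> borel G) by apply.
  apply: continuous_measurable_borel2; try exact: lcsc_second_countable.
  by apply: continuousMg; [apply: continuousVg => x; exact: cvg_fst|move=> x; exact: cvg_snd].
have W0 : (lam \x lam)%E W = 0%E.
  apply: integral0_eq => x _ /=; rewrite -A0 -(haar_mulgl (x : G)^-1%g mA).
  by congr (lam _); apply/seteqP; split => y /=; rewrite /xsection/= inE.
have mAi : measurable [set k : borel G | A (k^-1%g : G)].
  by rewrite -[X in measurable X]setTI; exact: measurable_invg.
have := prod_null_swap mW W0.
have -> : (fun y => lam (ysection W y)) = cst (lam [set k : borel G | A (k^-1%g : G)]).
  apply/funext => y /=; rewrite -(haar_mulgl (y : G)^-1%g mAi).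
  by congr (lam _); apply/seteqP; split => x /=; rewrite /ysection/= inE /W /= invgM invgK.
rewrite integral_cst// => /eqP; rewrite mule_eq0 (negbTE haar_neq0) orbF => /eqP.
exact.
Qed.

Lemma haar_compact_gt0 : exists K : set G, compact K /\ (0 < lam K)%E.
Proof.
have [Q [cQ ndQ Qx]] := lcsc_exhaustion G.
apply: contrapT => H; have /negP := haar_neq0; apply.
have -> : setT = \bigcup_n (Q n) by apply/seteqP; split => // x _; have [n ?] := Qx x; exists n.
apply/eqP/negligibleP; first by apply: bigcup_measurable => n _; exact: measurable_compactg.
apply: negligible_bigcup => n; apply/negligibleP; first exact: measurable_compactg.
apply/eqP; rewrite eq_le measure_ge0 andbT leNgt; apply/negP => Qn.
by apply: H; exists (Q n).
Qed.

End haar.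

Lemma measureU_eq0 (R : realType) d (T : measurableType d) (m : {measure set T -> \bar R}) (A B : set T) :
  measurable A -> measurable B -> m A = 0%E -> m B = 0%E -> m (A `|` B) = 0%E.
Proof.
by move=> mA mB A0 B0; rewrite measureU0.
Qed.

(** * Properness of the cocycle *)

Section properness.
Context (R : realType) (G H : lcscGroupType).
Variables (lamG : {sigma_finite_measure set (borel G) -> \bar R})
          (lamH : {sigma_finite_measure set (borel H) -> \bar R}).
Hypotheses (haarG : haar_measure lamG) (haarH : haar_measure lamH).
Context dO (Omega : measurableType dO) (eta : probability Omega R) (act : G -> Omega -> Omega).
Context dY (Y : measurableType dY) (nu : probability Y R) (psi : Y * borel G -> Omega).
Hypothesis psi_iso : mcp_isomorphism (nu \x lamG)%E eta psi.
Hypothesis psi_act : forall g : G, \forall q \ae (nu \x lamG)%E,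
  psi (q.1, (g * q.2)%g) = act g (psi q).
Context dX (X : measurableType dX) (mu : probability X R) (phi : X * borel H -> Omega).
Hypothesis phi_iso : mcp_isomorphism (mu \x lamH)%E eta phi.
Context (actX : G -> X -> X) (omega : G * X -> H).
Hypothesis phi_act : forall g : G, \forall p \ae (mu \x lamH)%E,
  act g (phi p) = phi (actX g p.1, (p.2 * (omega (g, p.1))^-1)%g).

Lemma translate_null (N : set (Y * borel G)) (g : G) : measurable N ->
  (nu \x lamG)%E N = 0%E ->
  measurable [set q : Y * borel G | N (q.1, (g * (q.2 : G))%g : borel G)] /\
  (nu \x lamG)%E [set q : Y * borel G | N (q.1, (g * (q.2 : G))%g : borel G)] = 0%E.
Proof.
move=> mN N0; split.
  rewrite -[X in measurable X]setTI.
  have m : measurable_fun setT (fun q : Y * borel G => (q.1, (g * (q.2 : G))%g : borel G)).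
    apply: measurable_fun_pair; first exact: measurable_fst.
    by apply: (measurableT_comp (measurable_mulgl g)); exact: measurable_snd.
  exact: m.
rewrite -[RHS]N0; apply: eq_integral => y _ /=.
rewrite -(haar_mulgl haarG g (measurable_xsection y mN)).
by congr (lamG _); apply/seteqP; split => k /=; rewrite /xsection/= !inE.
Qed.

(** The G-coordinate of the identification of Omega with Y * G, read on X * H. *)
Lemma equivariant_coordinate : exists (D : set (X * borel H)) (kap : X * borel H -> borel G),
  [/\ measurable D, (mu \x lamH)%E (~` D) = 0%E, measurable_fun D kap &
      forall g : G, \forall p \ae (mu \x lamH)%E, D p ->
        D (actX g p.1, (p.2 * (omega (g, p.1))^-1)%g) ->
        kap (actX g p.1, (p.2 * (omega (g, p.1))^-1)%g) = (g * kap p)%g].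
Proof.
have [D [E [_ [[mD mE D0 E0] [_ _ _ _] mphi _ phiE]]]] := phi_iso.
have [D' [E' [g' [[mD' mE' D'0 E'0] [DE' ED' psiK g'K] mpsi mg' psiE]]]] := psi_iso.
exists (D `&` phi @^-1` E'), (fun p => (g' (phi p)).2).
have mD1 : measurable (D `&` phi @^-1` E') by exact: mphi.
split => //.
- have mC : measurable (D `&` phi @^-1` (~` E')) by apply: mphi => //; exact: measurableC.
  apply: (@subset_measure0 _ _ _ (mu \x lamH)%E _ (~` D `|` (D `&` phi @^-1` (~` E')))).
  + exact: measurableC.
  + by apply: measurableU => //; exact: measurableC.
  + by move=> p /= nDp; have [Dp|] := pselect (D p); [right; split => // E'p; exact: nDp|left].
  + apply: (@measureU_eq0 _ _ _ (mu \x lamH)%E) => //; first exact: measurableC.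
    by apply/phiE; [exact: measurableC|exact: E'0].
- apply: (measurableT_comp measurable_snd).
  apply: (measurable_comp mE' _ mg'); first by move=> _ [p [_ ?] <-].
  by apply: measurable_funS mphi => //; exact: subIsetl.
- move=> g.
  have [N1 [mN1 N10 sN1]] := psi_act g.
  have [N3 [mN3 N30 sN3]] := phi_act g.
  have [mN2 N20] := @translate_null _ g (measurableC mD') D'0.
  set N2 := [set q | _] in mN2 N20.
  pose N := N1 `|` N2.
  have mN : measurable N by exact: measurableU.
  have N0 : (nu \x lamG)%E N = 0%E.
    exact: (@measureU_eq0 _ _ _ (nu \x lamG)%E).
  pose A := E' `&` g' @^-1` N.
  have mA : measurable A by exact: mg'.
  have A0 : eta A = 0%E.
    apply/psiE => //; apply: (@subset_measure0 _ _ _ (nu \x lamG)%E _ N) => //.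
      exact: mpsi.
    by move=> q [D'q [_ /=]]; rewrite psiK ?inE.
  have B0 : (mu \x lamH)%E (D `&` phi @^-1` A) = 0%E by apply/phiE.
  exists ((D `&` phi @^-1` A) `|` N3); split.
  + by apply: measurableU => //; exact: mphi.
  + by apply: (@measureU_eq0 _ _ _ (mu \x lamH)%E) => //; exact: mphi.
  + move=> p /= nP; apply: contrapT => /not_orP[nA nN3]; apply: nP => -[Dp E'p] _.
    have E3 : act g (phi p) = phi (actX g p.1, (p.2 * (omega (g, p.1))^-1)%g).
      by apply: contrapT => h; apply: nN3; exact: sN3.
    have nN : ~ N (g' (phi p)) by move=> h; apply: nA.
    have E1 : psi ((g' (phi p)).1, (g * (g' (phi p)).2)%g) = act g (psi (g' (phi p))).
      by apply: contrapT => h; apply: nN; left; exact: sN1.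
    have E2 : D' ((g' (phi p)).1, (g * (g' (phi p)).2)%g).
      by apply: contrapT => h; apply: nN; right.
    rewrite -E3 -(_ : psi ((g' (phi p)).1, (g * (g' (phi p)).2)%g) = act g (phi p)).
      by rewrite psiK ?inE.
    by rewrite E1 g'K ?inE.
Qed.

Lemma ae_section_inv (N : set (X * borel H)) : measurable N ->
  (mu \x lamH)%E N = 0%E ->
  \forall x \ae mu, lamH [set k : borel H | N (x, (k : H)^-1%g : borel H)] = 0%E.
Proof.
move=> mN N0; have := null_xsection mN N0; apply: filterS => x Nx0.
have := haar_null_inv haarH (measurable_xsection x mN) Nx0.
by congr (lamH _ = _); apply/seteqP; split => k /=; rewrite /xsection/= inE.
Qed.

(** Let kap be the G-coordinate on X * H. As G is a union of compact sets Q n, for most x it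
    maps most of the fibre over x into a fixed compact set Q n; here a fibre is tested on a
    set B of finite measure only, and points of H are inverted so that the right
    multiplication by the cocycle becomes a left one, which preserves Haar measure. When x
    and r x both have this property and the value l of the cocycle at (r, x) lies in L, some
    k satisfies it over x and, as l * k, over r x. Equivariance then gives
    r = kap (r x, (l * k)^-1) * kap (x, k^-1)^-1, which lies in Q n * Q n^-1. *)
Lemma cocycle_proper (mu' : probability X R) (L : set H) (e : R) :
  mu' `<< mu -> compact L -> 0 < e ->
  exists (X0 : set X) (Q : set G),
  [/\ measurable X0, (mu' (~` X0) < e%:E)%E, compact Q &
      forall r, ~ Q r ->
        \forall x \ae mu', ~ (X0 x /\ X0 (actX r x) /\ L (omega (r, x)))].
Proof.
move=> /null_content_dominatesP dom cL e0.
have aedom (P : X -> Prop) : (\forall x \ae mu, P x) -> \forall x \ae mu', P x.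
  by move=> [N [mN N0 sN]]; exists N; split => //; exact: dom.
have [D [kap [mD D0 mkap kapE]]] := equivariant_coordinate.
have [Q [cQ ndQ Qx]] := lcsc_exhaustion G.
have [K [cK K0]] := haar_compact_gt0 haarH.
have Koo := haar_compact haarH cK.
(* For k in K and l in L, both k and l * k lie in B. *)
pose LK : set H := [set (p.1 * p.2)%g | p in L `*` K].
have cLK : compact LK by exact: compact_mulg.
pose B : set (borel H) := K `|` LK.
have mB : measurable B by apply: measurableU; exact: measurable_compactg.
have Boo : (lamH B < +oo)%E by apply: haar_compact => //; exact: compactU.
pose inv2 (p : X * borel H) : X * borel H := (p.1, (p.2 : H)^-1%g).
have minv2 : measurable_fun setT inv2.
  apply: measurable_fun_pair; first exact: measurable_fst.
  by apply: (measurableT_comp (@measurable_invg H)); exact: measurable_snd.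
pose C n : set (X * borel H) := D `&` kap @^-1` (Q n : set (borel G)).
have mC n : measurable (C n) by apply: mkap => //; exact: measurable_compactg.
pose S n : set (X * borel H) := (setT `*` B) `\` (inv2 @^-1` (C n)).
have mS n : measurable (S n).
  apply: measurableD; first exact: measurableX.
  by rewrite -[X in measurable X]setTI; exact: minv2.
have SE n x : xsection (S n) x = B `\` [set k | C n (x, (k : H)^-1%g : borel H)].
  by apply/seteqP; split => k; rewrite /xsection/= inE /= => -[] //= [].
pose c := fine (lamH K).
have cE : lamH K = c%:E by rewrite /c fineK// ge0_fin_numE.
have c0 : 0 < c by rewrite -lte_fin -cE.
pose good n : set X := [set x | (lamH (xsection (S n) x) < (c / 2)%:E)%E].
have mgood n : measurable (good n).
  rewrite /good -[X in measurable X]setTI.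
  exact: (emeasurable_fun_infty_o measurableT (measurable_fun_xsection lamH (mS n))).
have ndC n m : (n <= m)%N -> C n `<=` C m by move=> nm p [Dp Qp]; split => //; exact: ndQ Qp.
have niS n m x : (n <= m)%N -> xsection (S m) x `<=` xsection (S n) x.
  by move=> nm; rewrite !SE => k [Bk nC]; split => // Ck; apply: nC; exact: ndC Ck.
have ndX n m : (n <= m)%N -> good n `<=` good m.
  move=> nm x; apply: le_lt_trans; apply: le_measure; rewrite ?inE; try exact: measurable_xsection.
  exact: niS.
have aeX : \forall x \ae mu', exists n, good n x.
  apply: aedom; have := ae_section_inv (measurableC mD) D0.
  apply: filterS => x Dx.
  have cap0 : lamH (\bigcap_n xsection (S n) x) = 0%E.
    apply: (@subset_measure0 _ _ _ lamH _ [set k : borel H | (~` D) (x, (k : H)^-1%g : borel H)]) => //.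
    - by apply: bigcap_measurable => // n _; exact: measurable_xsection.
    - rewrite -[X in measurable X]setTI.
      have m2 := measurableT_comp minv2 (measurable_pair1 x).
      by apply: m2 => //; exact: measurableC.
    - move=> k Sk Dk; have [n Qn] := Qx (kap (x, (k : H)^-1%g : borel H)).
      by have := Sk n I; rewrite SE => -[_]; apply.
  have cvg0 : (lamH \o (fun n => xsection (S n) x)) @ \oo --> lamH (\bigcap_n xsection (S n) x).
    apply: nonincreasing_cvg_mu.
    - apply: le_lt_trans Boo; apply: le_measure; rewrite ?inE//; first exact: measurable_xsection.
      by rewrite SE => k [].
    - by move=> n; exact: measurable_xsection.
    - by apply: bigcap_measurable => // n _; exact: measurable_xsection.
    - by move=> n m nm; apply/subsetPset; exact: niS.
  rewrite cap0 in cvg0.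
  have : \forall n \near \oo, (lamH (xsection (S n) x) < (c / 2)%:E)%E.
    apply: (cvg0 [set y | (y < (c / 2)%:E)%E]).
    apply: open_nbhs_nbhs; split; first exact: open_ereal_lt_ereal.
    by rewrite /= lte_fin divr_gt0.
  by move=> [n _ Hn]; exists n; apply: Hn => /=.
have [n Xn] : exists n, (mu' (~` good n) < e%:E)%E.
  have cap0 : mu' (\bigcap_n ~` good n) = 0%E.
    have [N [mN N0 sN]] := aeX.
    apply: (@subset_measure0 _ _ _ mu' _ N) => //.
      by apply: bigcap_measurable => // n _; exact: measurableC.
    by move=> x Hx; apply: sN => -[n Xn]; exact: (Hx n).
  have cvg0 : (mu' \o (fun n => ~` good n)) @ \oo --> mu' (\bigcap_n ~` good n).
    apply: nonincreasing_cvg_mu.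
    - by apply: le_lt_trans (ltry 1); apply: probability_le1; exact: measurableC.
    - by move=> n; exact: measurableC.
    - by apply: bigcap_measurable => // n _; exact: measurableC.
    - by move=> n m nm; apply/subsetPset; apply: subsetC; exact: ndX.
  rewrite cap0 in cvg0.
  have : \forall n \near \oo, (mu' (~` good n) < e%:E)%E.
    apply: (cvg0 [set y | (y < e%:E)%E]).
    apply: open_nbhs_nbhs; split; first exact: open_ereal_lt_ereal.
    by rewrite /= lte_fin.
  by move=> [n _ Hn]; exists n; apply: Hn => /=.
exists (good n), [set (p.1 * p.2)%g | p in Q n `*` [set x^-1%g | x in Q n]].
split => //; first by apply: compact_mulg => //; exact: compact_invg.
move=> r Qr.
have [N [mN N0 sN]] := kapE r.
apply: aedom; have := ae_section_inv mN N0; apply: filterS => x Nx0 [Xx [Xrx Lx]].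
pose l := omega (r, x).
have mNx : measurable [set k : borel H | N (x, (k : H)^-1%g : borel H)].
  rewrite -[X in measurable X]setTI.
  exact: (measurableT_comp minv2 (measurable_pair1 x)).
pose S1 := xsection (S n) x.
pose S2 := [set k : borel H | xsection (S n) (actX r x) (l * (k : H))%g].
have mS1 : measurable S1 by exact: measurable_xsection.
have mS2 : measurable S2.
  rewrite -[X in measurable X]setTI.
  by apply: (measurable_mulgl l) => //; exact: measurable_xsection.
have S2E : lamH S2 = lamH (xsection (S n) (actX r x)).
  by apply: haar_mulgl => //; exact: measurable_xsection.
(* S1 and S2 have measure less than c / 2 each, and K has measure c. *)
have [k [Kk nS]] : exists k, K k /\ ~ (S1 `|` S2 `|` [set k : borel H | N (x, (k : H)^-1%g : borel H)]) k.
  apply: contrapT => Hk.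
  have sub : (K : set (borel H)) `<=` S1 `|` S2 `|` [set k : borel H | N (x, (k : H)^-1%g : borel H)].
    by move=> k Kk; apply: contrapT => nk; apply: Hk; exists k.
  have : (lamH K < lamH K)%E.
    apply: (@le_lt_trans _ _ (lamH S1 + lamH S2)%E).
      apply: (@le_trans _ _ (lamH (S1 `|` S2))); last exact: measureU2.
      rewrite -(measureU0 (measurableU _ _ mS1 mS2) mNx Nx0).
      apply: le_measure; rewrite ?inE//; first exact: measurable_compactg.
      by apply: measurableU => //; exact: measurableU.
    have -> : lamH K = ((c / 2)%:E + (c / 2)%:E)%E.
      by rewrite cE -EFinD; congr (_%:E); lra.
    by apply: lteD; [exact: Xx|rewrite S2E; exact: Xrx].
  by rewrite ltxx.
have nS1 : ~ S1 k by move=> h; apply: nS; left; left.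
have nS2 : ~ S2 k by move=> h; apply: nS; left; right.
have nN : ~ N (x, (k : H)^-1%g : borel H) by move=> h; apply: nS; right.
have [Dp Qp] : C n (x, (k : H)^-1%g : borel H).
  by apply: contrapT => h; apply: nS1; rewrite /S1 SE; split => //; left.
have [Dq Qq] : C n (actX r x, ((k : H)^-1 * l^-1)%g : borel H).
  apply: contrapT => h; apply: nS2; rewrite /S2 /= SE; split => /=.
    by right; exists (l, k).
  by rewrite invgM.
apply: Qr.
have kE : kap (actX r x, ((k : H)^-1 * l^-1)%g : borel H) =
    (r * kap (x, (k : H)^-1%g : borel H))%g.
  by apply: contrapT => h; apply: nN; apply: sN => /= /(_ Dp Dq).
exists (kap (actX r x, ((k : H)^-1 * l^-1)%g : borel H), (kap (x, (k : H)^-1%g : borel H) : G)^-1%g) => /=.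
  by split => //=; exists (kap (x, (k : H)^-1%g : borel H)).
by rewrite kE mulgK.
Qed.

End properness.

(** * Averaging over a compact set *)

(** The translates of P vary continuously in total variation. *)
Definition translation_continuous (R : realType) (G : lcscGroupType)
    (P : probability (borel G) R) : Prop :=
  forall (g : G) (e : R), 0 < e -> \forall g' \near g,
  forall (a : borel G -> R) (M : R), measurable_fun setT a -> (forall x, `|a x| <= M) ->
    `| \int[P]_s a (g * (s : G))%g - \int[P]_s a (g' * (s : G))%g | <= e * M.

Section averaging.
Context (R : realType) (G : lcscGroupType) (lam : {sigma_finite_measure set (borel G) -> \bar R}).
Hypothesis lam_haar : haar_measure lam.

Lemma measurable_translate (g : G) (A : set (borel G)) :
  measurable A -> measurable [set s : borel G | A (g * (s : G))%g].
Proof. by move=> mA; rewrite -[X in measurable X]setTI; exact: (measurable_mulgl g). Qed.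

(** Along a decreasing basis V n of neighbourhoods of 1, the sets V n * U decrease to the
    compact set U and have finite measure. *)
Lemma haar_shift_small (U : set G) (e : R) : compact U -> 0 < e ->
  \forall h \near (1%g : G), (lam [set s : borel G | U (s : G) /\ ~ U (h * (s : G))%g] < e%:E)%E.
Proof.
move=> cU e0; have [b [ob nb]] := second_countable_basis (@lcsc_second_countable G).
have [C nC [cC _]] := @lcsc_locally_compact G 1%g I.
have nC' : nbhs (1%g : G) C by move: nC; rewrite /within/=; apply: filterS => y; exact.
pose V n : set G := iteri n (fun i A => A `&` [set x | b i 1%g -> b i x]) (interior C).
have oV n : open (V n).
  elim: n => [|n IH] /=; first exact: open_interior.
  apply: openI => //; have [b1|b1] := pselect (b n 1%g).
    by rewrite (_ : [set x | _] = b n)//; apply/seteqP; split => x /=; exact.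
  by rewrite (_ : [set x | _] = setT); [exact: openT|by apply/seteqP; split => // x _ /b1].
have V1 n : V n 1%g by elim: n => [|n IH] //=; exact: nbhs_singleton nC'.
have Vdec n m : (n <= m)%N -> V m `<=` V n.
  elim: m => [|m IH]; first by rewrite leqn0 => /eqP ->.
  rewrite leq_eqVlt => /orP[/eqP -> //|]; rewrite ltnS => /IH h.
  by apply: subset_trans h => x [].
have VC n : V n `<=` C by apply: subset_trans (Vdec 0 n _) _ => //; exact: interior_subset.
have Vsmall W : nbhs (1%g : G) W -> exists n, V n `<=` W.
  move=> /nb[n [bn1 bnW]]; exists n.+1 => x /= [_ /(_ bn1)]; exact: bnW.
pose VU n : set (borel G) := \bigcup_(u in U) [set x : G | V n (x * u^-1)%g].
have oVU n : open (VU n : set G).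
  apply: bigcup_open => u _.
  have c : continuous (fun x : G => (x * u^-1)%g).
    by apply: continuousMg; [exact: continuous_idg|exact: continuous_cstg].
  by move: (oV n); apply: open_comp => x _; exact: c.
have mU := measurable_compactg cU.
pose F n : set (borel G) := VU n `\` U.
have mF n : measurable (F n) by apply: measurableD => //; exact: borel_open.
have cap0 : \bigcap_n F n = set0.
  apply/seteqP; split => // x Fx; have [_ nUx] := Fx 0 I.
  have cl : open (~` U) by apply: closed_openC; apply: compact_closed cU; exact: lcsc_hausdorff.
  have c : continuous (fun v : G => (v^-1 * (x : G))%g).
    by apply: continuousMg; [apply: continuousVg; exact: continuous_idg|exact: continuous_cstg].
  have /Vsmall[n Vn] : nbhs (1%g : G) [set v | ~ U (v^-1 * (x : G))%g].
    have := c 1%g (~` U); apply; rewrite invg1 mul1g; exact: open_nbhs_nbhs.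
  have [[u Uu Vx] _] := Fx n I; apply: (Vn _ Vx).
  by rewrite /= invgM invgK mulgVK.
have cvg0 : (lam \o F) @ \oo --> lam (\bigcap_n F n).
  apply: nonincreasing_cvg_mu => //.
  - apply: (@le_lt_trans _ _ (lam [set (p.1 * p.2)%g | p in C `*` U])); last first.
      by apply: haar_compact => //; exact: compact_mulg.
    apply: le_measure; rewrite ?inE//; first by apply: measurable_compactg; exact: compact_mulg.
    move=> x [[u Uu /VC Cx] _]; exists ((x : G) * u^-1, u)%g => //=.
    exact: mulgVK.
  - by rewrite cap0.
  - move=> n m nm; apply/subsetPset => x [[u Uu Vx] nUx]; split => //.
    by exists u => //; exact: Vdec Vx.
rewrite cap0 measure0 in cvg0.
have : \forall n \near \oo, ((lam \o F) n < e%:E)%E.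
  apply: (cvg0 [set y | (y < e%:E)%E]).
  by apply: open_nbhs_nbhs; split; [exact: open_ereal_lt_ereal|rewrite /= lte_fin].
move=> [n _ /(_ n (leqnn _)) Fn].
have : nbhs (1%g : G) (V n) by apply: open_nbhs_nbhs.
apply: filterS => h Vh; apply: le_lt_trans Fn => /=.
have mS : measurable [set s : borel G | U (s : G) /\ ~ U (h * (s : G))%g].
  by apply: measurableI => //; exact: (measurable_translate h (measurableC mU)).
rewrite -(haar_mulgl lam_haar h^-1%g mS).
apply: le_measure; rewrite ?inE//.
  exact: measurable_translate.
move=> x /= [Ux nUx]; split.
  by exists (h^-1 * (x : G))%g => //=; rewrite invgM invgK mulVKg.
by move=> h'; apply: nUx; rewrite mulVKg.
Qed.

(** P is Haar measure on a compact set U, normalized. Its translates by g and g' agree on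
    the intersection W of g U and g' U, and give little mass to the rest. *)
Lemma averaging_probability : exists (U : set G) (P : probability (borel G) R),
  [/\ compact U, P (~` (U : set (borel G))) = 0%E &
      translation_continuous P].
Proof.
have [U [cU U0]] := haar_compact_gt0 lam_haar.
have Uoo := haar_compact lam_haar cU.
have mU := measurable_compactg cU.
pose c := fine (lam U).
have cE : lam U = c%:E by rewrite /c fineK// ge0_fin_numE.
have c0 : 0 < c by rewrite -lte_fin -cE.
pose m := mfrestr mU Uoo.
(* The Dirac mass is the value of mnormalize for measures of total mass 0 or oo only. *)
pose P : probability (borel G) R := mnormalize m (@dirac _ (borel G) (1%g : G) R : probability (borel G) R).
have PE (A : set (borel G)) : P A = (lam (A `&` U) * (c^-1)%:E)%E.
  rewrite /P /= /mnormalize /= /m /mfrestr /mrestr setTI cE /=.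
  by rewrite ifF// eqe gt_eqF.
exists U, P; split => //; first by rewrite PE setICl measure0 mul0e.
have PUC : P (~` (U : set (borel G))) = 0%E by rewrite PE setICl measure0 mul0e.
pose q (h : G) : \bar R := P [set s : borel G | ~ U (h * (s : G))%g].
have qE h : q h = (lam [set s : borel G | U (s : G) /\ ~ U (h * (s : G))%g] * (c^-1)%:E)%E.
  by rewrite /q PE setIC.
move=> g e e0.
have qsmall : \forall h \near (1%g : G), (q h < (e / 2)%:E)%E.
  have ce : 0 < e / 2 * c by rewrite mulr_gt0// divr_gt0.
  apply: filterS (haar_shift_small cU ce) => h.
  rewrite qE => hlt; rewrite lte_pdivrMr//.
have c1 : continuous (fun g' : G => (g'^-1 * g)%g).
  by apply: continuousMg; [apply: continuousVg; exact: continuous_idg|exact: continuous_cstg].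
have c2 : continuous (fun g' : G => (g^-1 * g')%g).
  by apply: continuousMg; [exact: continuous_cstg|exact: continuous_idg].
have n1 : \forall g' \near g, (q (g'^-1 * g)%g < (e / 2)%:E)%E.
  by have := c1 g [set h | (q h < (e / 2)%:E)%E]; apply; rewrite mulVg.
have n2 : \forall g' \near g, (q (g^-1 * g')%g < (e / 2)%:E)%E.
  by have := c2 g [set h | (q h < (e / 2)%:E)%E]; apply; rewrite mulVg.
apply: filterS2 n1 n2 => g' q1 q2 a M ma aM.
pose W : set (borel G) := [set t | U (g^-1 * (t : G))%g /\ U (g'^-1 * (t : G))%g].
have mW : measurable W by apply: measurableI; exact: measurable_translate.
have ia k : P.-integrable setT (EFin \o (fun s => a (k * (s : G))%g)).
  apply: (@bounded_integrable _ _ _ _ _ M) => //.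
  exact: (measurableT_comp ma (measurable_mulgl k)).
have split_int k : \int[P]_s a (k * (s : G))%g =
    \int[P]_(s in [set s : borel G | W (k * (s : G))%g]) a (k * (s : G))%g +
    \int[P]_(s in ~` [set s : borel G | W (k * (s : G))%g]) a (k * (s : G))%g.
  rewrite -Rintegral_setU ?setUv//; first exact: measurable_translate.
  - by apply: measurableC; exact: measurable_translate.
  - by apply/disj_setPS => s [].
have W_int : \int[P]_(s in [set s : borel G | W (g * (s : G))%g]) a (g * (s : G))%g =
    \int[P]_(s in [set s : borel G | W (g' * (s : G))%g]) a (g' * (s : G))%g.
  have mEa : measurable_fun setT (EFin \o a) by exact/measurable_EFinP.
  have iW k : P.-integrable [set s : borel G | W (k * (s : G))%g] (EFin \o (fun s => a (k * (s : G))%g)).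
    by apply: integrableS (ia k) => //; exact: measurable_translate.
  have pf k := @integral_pushforward _ _ _ _ _ _ (measurable_mulgl k) P W (EFin \o a) mEa (iW k) mW.
  rewrite /Rintegral; congr fine.
  transitivity (\int[pushforward P (fun s : borel G => (g * (s : G))%g : borel G)]_(y in W) (EFin \o a) y)%E.
    by rewrite pf.
  transitivity (\int[pushforward P (fun s : borel G => (g' * (s : G))%g : borel G)]_(y in W) (EFin \o a) y)%E; last first.
    by rewrite pf.
  apply: eq_measure_integral; [exact: measurable_mulgl|exact: measurable_mulgl|move=> ? ? A mA AW].
  have H k : (forall t, W t -> U (k^-1 * (t : G))%g) ->
      lam ([set s : borel G | A (k * (s : G))%g] `&` U) = lam A.
    move=> HW; rewrite -[RHS](haar_mulgl lam_haar k mA); congr (lam _).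
    apply/seteqP; split => [s []//|s /= As]; split => //.
    by have := HW _ (AW _ As); rewrite mulKg.
  have Hk k : (forall t, W t -> U (k^-1 * (t : G))%g) ->
      P [set s : borel G | A (k * (s : G))%g] = (lam A * (c^-1)%:E)%E.
    by move=> HW; rewrite PE H.
  transitivity (lam A * (c^-1)%:E)%E; first by apply: Hk => t [].
  by apply/esym; apply: Hk => t [].
have rest k k' : (q (k'^-1 * k)%g < (e / 2)%:E)%E ->
    (forall s : G, U s -> U (k'^-1 * k * s)%g -> W (k * s)%g) ->
    `| \int[P]_(s in ~` [set s : borel G | W (k * (s : G))%g]) a (k * (s : G))%g | <= e / 2 * M.
  move=> qk HW; have M0 : 0 <= M by apply: le_trans (aM 1%g); exact: normr_ge0.
  have mC : measurable (~` [set s : borel G | W (k * (s : G))%g]).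
    by apply: measurableC; exact: measurable_translate.
  have iC : P.-integrable (~` [set s : borel G | W (k * (s : G))%g]) (EFin \o (fun s => a (k * (s : G))%g)).
    exact: integrableS (ia k).
  apply: (le_trans (le_normr_Rintegral mC iC)).
  apply: (@le_trans _ _ (\int[P]_(s in ~` [set s : borel G | W (k * (s : G))%g]) M)).
    apply: le_Rintegral => //; first exact: integrable_norm.
    exact: finite_measure_integrable_cst.
  rewrite Rintegral_cst// mulrC ler_wpM2r// -lee_fin fineK ?fin_num_measure//.
  apply: le_trans (ltW qk).
  apply: (@le_trans _ _ (P (~` (U : set (borel G)) `|` [set s : borel G | ~ U (k'^-1 * k * (s : G))%g]))).
    apply: le_measure; rewrite ?inE//.
      by apply: measurableU; [exact: measurableC|
        exact: (measurable_translate (k'^-1 * k)%g (measurableC mU))].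
    move=> s /= nW; have [Us|] := pselect (U s); [right => Us'|by left].
    by apply: nW; exact: HW.
  rewrite /q setUC measureU0//;
    [exact: (measurable_translate (k'^-1 * k)%g (measurableC mU))|exact: measurableC].
rewrite !split_int W_int opprD addrACA subrr add0r.
apply: (le_trans (ler_normB _ _)).
have -> : e * M = e / 2 * M + e / 2 * M by field.
apply: lerD; [apply: (rest _ g') => //|apply: (rest _ g) => //].
- by move=> s Us Us'; rewrite /W /= mulKg mulgA.
- by move=> s Us Us'; rewrite /W /= mulKg mulgA.
Qed.

End averaging.

(** * Continuity of Hilbert space valued maps *)

Section complex_continuity.
Variable R : realType.

Lemma ltc_cabs (z : R[i]) (e : R[i]) : 0 < e -> (`|z| < e) = (cabs z < complex.Re e).
Proof.
case: e => a b; rewrite ltcE /= => /andP[/eqP -> a0].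
by rewrite -cabsE ltcR.
Qed.

Lemma continuous_cabsP (T : topologicalType) (f : T -> R[i]^o) :
  continuous f <->
  forall (x : T) (e : R), 0 < e -> \forall y \near x, cabs ((f x : R[i]) - f y) < e.
Proof.
split=> [cf x e e0|H x].
  have e0' : 0 < e%:C%C :> R[i] by rewrite ltcR.
  have /cvgrPdist_lt/(_ _ e0') := cf x.
  by apply: filterS => y; rewrite ltc_cabs.
apply/cvgrPdist_lt => e e0.
have e0' : 0 < complex.Re e by case: e e0 => a b; rewrite ltcE => /andP[].
apply: filterS (H x _ e0') => y.
by rewrite (ltc_cabs _ e0).
Qed.

Lemma continuous_Re (T : topologicalType) (f : T -> R[i]^o) :
  continuous f -> continuous (fun x => complex.Re (f x)).
Proof.
move=> /continuous_cabsP cf x; apply/cvgrPdist_lt => e e0.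
apply: filterS (cf x e e0) => y; apply: le_lt_trans.
by rewrite -raddfB; exact: normr_Re_le.
Qed.

Lemma continuous_Im (T : topologicalType) (f : T -> R[i]^o) :
  continuous f -> continuous (fun x => complex.Im (f x)).
Proof.
move=> /continuous_cabsP cf x; apply/cvgrPdist_lt => e e0.
apply: filterS (cf x e e0) => y; apply: le_lt_trans.
by rewrite -raddfB; exact: normr_Im_le.
Qed.

Lemma bounded_meas_continuous (T : ptopologicalType) (f : T -> R[i]^o) (M : R) :
  continuous f -> (forall x, cabs (f x) <= M) -> bounded_meas (f : borel T -> R[i]).
Proof.
move=> cf fM; split; last by exists M.
- exact: (measurableT_comp (@measurable_real_borel R) (continuous_measurable_borel (continuous_Re cf))).
- exact: (measurableT_comp (@measurable_real_borel R) (continuous_measurable_borel (continuous_Im cf))).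
Qed.

Lemma bounded_meas_continuous2 (T U : ptopologicalType) (f : T * U -> R[i]^o) (M : R) :
  @second_countable T -> @second_countable U ->
  continuous f -> (forall x, cabs (f x) <= M) -> bounded_meas (f : borel T * borel U -> R[i]).
Proof.
move=> cT cU cf fM; split; last by exists M.
- exact: (measurableT_comp (@measurable_real_borel R)
    (continuous_measurable_borel2 cT cU (continuous_Re cf))).
- exact: (measurableT_comp (@measurable_real_borel R)
    (continuous_measurable_borel2 cT cU (continuous_Im cf))).
Qed.

End complex_continuity.

Section hilbert.
Context (R : realType) (V : hilbertSpace R).
Implicit Types u v w : V.

Lemma innerZl a u v : inner V (a *: u) v = a * inner V u v.
Proof. exact: (linearZl_LR (inner V)). Qed.

Lemma innerZr a u v : inner V u (a *: v) = conjC a * inner V u v.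
Proof. exact: (linearZr_LR (inner V)). Qed.

Lemma hnorm_sq v : inner V v v = (hnorm v ^+ 2)%:C%C.
Proof.
rewrite inner_norm /hnorm rmorphXn /=; congr (_ ^+ 2).
by rewrite RRe_real// normr_real.
Qed.

Lemma hnorm_ge0 v : 0 <= hnorm v.
Proof.
by rewrite -ler0c /hnorm RRe_real ?normr_real.
Qed.

Lemma inner_psd : psd (fun u v : V => inner V u v).
Proof.
move=> n s c; pose w := \sum_i conjC (c i) *: s i.
have -> : \sum_i \sum_j conjC (c i) * c j * inner V (s i) (s j) = inner V w w.
  rewrite /w linear_sumlz; apply: eq_bigr => i _.
  rewrite linear_sumr; apply: eq_bigr => j _.
  apply/esym; etransitivity; first exact: innerZl.
  by rewrite -mulrA -{2}[c j]conjCK; congr (_ * _); exact: innerZr.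
by rewrite hnorm_sq ler0c sqr_ge0.
Qed.

Lemma inner_CS u v : cabs (inner V u v) <= hnorm u * hnorm v.
Proof.
have := psd_CS u v inner_psd; rewrite !hnorm_sq /= -exprMn => H.
rewrite -[leRHS]ger0_norm ?mulr_ge0 ?hnorm_ge0// -sqrtr_sqr /cabs.
by rewrite ler_wsqrtr.
Qed.

Lemma continuous_hnormP (T : topologicalType) (f : T -> V) :
  continuous f <->
  forall (x : T) (e : R), 0 < e -> \forall y \near x, hnorm (f x - f y) < e.
Proof.
have lt v (e : R[i]) : 0 < e -> (`|v| < e) = (hnorm v < complex.Re e).
  case: e => a b; rewrite ltcE /= => /andP[/eqP -> a0].
  by rewrite -[`|v|]RRe_real ?normr_real// ltcR.
split=> [cf x e e0|H x].
  have e0' : 0 < e%:C%C :> R[i] by rewrite ltcR.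
  have /cvgrPdist_lt/(_ _ e0') := cf x.
  by apply: filterS => y; rewrite lt.
apply/cvgrPdist_lt => e e0.
have e0' : 0 < complex.Re e by case: e e0 => a b; rewrite ltcE => /andP[].
apply: filterS (H x _ e0') => y.
by rewrite (lt _ _ e0).
Qed.

Lemma continuous_inner (T U : topologicalType) (f : T -> V) (k : U -> V) (A B : R) :
  continuous f -> continuous k -> (forall x, hnorm (f x) <= A) -> (forall y, hnorm (k y) <= B) ->
  continuous (fun p : T * U => inner V (f p.1) (k p.2) : R[i]^o).
Proof.
move=> /continuous_hnormP cf /continuous_hnormP ck fA kB.
apply/continuous_cabsP => -[x y] e e0 /=.
have A0 : 0 <= A by exact: le_trans (hnorm_ge0 (f x)) (fA x).
have B0 : 0 <= B by exact: le_trans (hnorm_ge0 (k y)) (kB y).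
pose d := e / (A + B + 1).
have S0 : 0 < A + B + 1 by rewrite ltr_wpDl// addr_ge0.
have d0 : 0 < d by rewrite divr_gt0.
exists ([set x' | hnorm (f x - f x') < d], [set y' | hnorm (k y - k y') < d]).
  by split; [exact: cf|exact: ck].
move=> [x' y'] [/= fx ky].
have -> : inner V (f x) (k y) - inner V (f x') (k y') =
    inner V (f x - f x') (k y) + inner V (f x') (k y - k y').
  by rewrite linearBl linearBr /=; ring.
apply: (le_lt_trans (cabsD _ _)).
apply: (@le_lt_trans _ _ (d * B + A * d)).
  apply: lerD; apply: (le_trans (inner_CS _ _)); apply: ler_pM; rewrite ?hnorm_ge0//; exact: ltW.
have -> : e = d * (A + B + 1) by rewrite /d divfK// gt_eqF.
rewrite !mulrDr mulr1 (mulrC A) [d * B + _]addrC ltrDl//.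
Qed.

End hilbert.

(** * Smoothing of kernels *)

Section smoothing.
Context (R : realType) (G : lcscGroupType) (P : probability (borel G) R).

Definition smooth (k : G -> G -> R[i]) (g h : G) : R[i] :=
  cint P (fun s => cint P (fun t => k (g * (s : G))%g (h * (t : G))%g)).

Definition bounded_meas2 (k : G -> G -> R[i]) :=
  bounded_meas (fun p : borel G * borel G => k p.1 p.2).

Lemma bounded_meas2_comp d (T : measurableType d) (u v : T -> borel G) (k : G -> G -> R[i]) :
  bounded_meas2 k -> measurable_fun setT u -> measurable_fun setT v ->
  bounded_meas (fun x => k (u x) (v x)).
Proof.
move=> bk mu mv; apply: (bounded_meas_comp (h := fun x => (u x, v x)) _ bk).
exact: measurable_fun_pair.
Qed.

Lemma bounded_meas2_shift k g h : bounded_meas2 k ->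
  bounded_meas2 (fun s t => k (g * s)%g (h * t)%g).
Proof.
move=> bk; apply: (@bounded_meas2_comp _ (borel G * borel G)%type
  (fun p => (g * (p.1 : G))%g) (fun p => (h * (p.2 : G))%g) k bk).
- exact: (measurableT_comp (measurable_mulgl g) measurable_fst).
- exact: (measurableT_comp (measurable_mulgl h) measurable_snd).
Qed.

Lemma smooth_le k M g h : bounded_meas2 k -> (forall s t, cabs (k s t) <= M) ->
  cabs (smooth k g h) <= 4 * M.
Proof.
move=> bk kM; have bs := bounded_meas2_shift g h bk.
have -> : 4 * M = 2 * (2 * M) by ring.
apply: cabs_cint_le; first exact: (bounded_meas_cint P P bs).
move=> s; apply: cabs_cint_le => //; exact: (bounded_meas_section1 bs).
Qed.

Hypothesis P_continuous : translation_continuous P.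

(** One neighbourhood serves all bounded kernels, since smooth k depends on g
    only through the translate of P. *)
Lemma smooth_equicontinuous (g : G) (e : R) : 0 < e -> \forall g' \near g,
  forall (k : G -> G -> R[i]) (M : R), bounded_meas2 k -> (forall s t, cabs (k s t) <= M) ->
  forall h, cabs (smooth k g h - smooth k g' h) <= e * M /\
            cabs (smooth k h g - smooth k h g') <= e * M.
Proof.
move=> e0; have e8 : 0 < e / 8 by rewrite divr_gt0.
apply: filterS (P_continuous g e8) => g' Hg' k M bk kM h.
have tv (a : borel G -> R[i]) M' : bounded_meas a -> (forall x, cabs (a x) <= M') ->
    cabs (cint P (fun s => a (g * (s : G))%g) - cint P (fun s => a (g' * (s : G))%g)) <= e / 4 * M'.
  move=> [ar ai _] aM; apply: (le_trans (cabs_le _)); rewrite /cint/=.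
  have -> : e / 4 * M' = e / 8 * M' + e / 8 * M' by field.
  apply: lerD.
    by apply: (Hg' (fun s => complex.Re (a s))) => // x; exact: le_trans (normr_Re_le _) (aM x).
  by apply: (Hg' (fun s => complex.Im (a s))) => // x; exact: le_trans (normr_Im_le _) (aM x).
split.
  rewrite /smooth; pose A (s : borel G) := cint P (fun t => k s (h * (t : G))%g).
  have bs := bounded_meas2_shift 1%g h bk.
  have bA : bounded_meas A.
    have := bounded_meas_cint P P bs.
    congr bounded_meas; apply/funext => s /=; rewrite /A.
    by congr (cint P _); apply/funext => t; rewrite mul1g.
  have AM s : cabs (A s) <= 2 * M.
    apply: cabs_cint_le => //.
    have := bounded_meas_section1 bs s.
    by congr bounded_meas; apply/funext => t /=; rewrite mul1g.
  have := tv A (2 * M) bA AM; move=> /le_trans; apply.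
  have M0 : 0 <= M by exact: le_trans (cabs_ge0 _) (kM 1%g 1%g).
  have -> : e / 4 * (2 * M) = e * M / 2 by field.
  have := mulr_ge0 (ltW e0) M0; lra.
have b1 := bounded_meas2_shift h g bk; have b2 := bounded_meas2_shift h g' bk.
have E : smooth k h g - smooth k h g' =
    cint P (fun s => cint P (fun t => k (h * (s : G))%g (g * (t : G))%g) +
      (-1) * cint P (fun t => k (h * (s : G))%g (g' * (t : G))%g)).
  rewrite cintD ?cintZ ?mulN1r//.
  - exact: (bounded_meas_cint P P b2).
  - exact: (bounded_meas_cint P P b1).
  - by apply: bounded_measZ; exact: (bounded_meas_cint P P b2).
rewrite E; have -> : e * M = 2 * (e / 2 * M) by field.
apply: cabs_cint_le.
  apply: bounded_measD; first exact: (bounded_meas_cint P P b1).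
  by apply: bounded_measZ; exact: (bounded_meas_cint P P b2).
move=> s; rewrite mulN1r.
have M0 : 0 <= M by exact: le_trans (cabs_ge0 _) (kM 1%g 1%g).
have bs : bounded_meas (fun t : borel G => k (h * (s : G))%g t).
  exact: (bounded_meas_section1 bk (h * (s : G))%g).
apply: (le_trans (tv (fun t : borel G => k (h * (s : G))%g t) M bs _)); first by move=> x; exact: kM.
have := mulr_ge0 (ltW e0) M0; lra.
Qed.

(** A quadratic form of the smoothed kernel is the double integral of the positive
    semidefinite kernel K s t obtained by moving all sample points by s and by t. *)
Lemma smooth_psd (I : Type) (k : I -> I -> G -> G -> R[i]) :
  (forall a b, bounded_meas2 (k a b)) ->
  psd (fun p q : G * I => k p.2 q.2 p.1 q.1) ->
  psd (fun p q : G * I => smooth (k p.2 q.2) p.1 q.1).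
Proof.
move=> bk kpsd n x c.
pose K (s t : borel G) := \sum_i \sum_j conjC (c i) * c j *
  k (x i).2 (x j).2 ((x i).1 * (s : G))%g ((x j).1 * (t : G))%g.
have bi i j : bounded_meas2 (fun s t => conjC (c i) * c j *
    k (x i).2 (x j).2 ((x i).1 * s)%g ((x j).1 * t)%g).
  by apply: bounded_measZ; exact: (bounded_meas2_shift (x i).1 (x j).1 (bk _ _)).
have Kb : bounded_meas (fun p : borel G * borel G => K p.1 p.2).
  by apply: bounded_meas_sum => i; apply: bounded_meas_sum => j; exact: bi.
have Kpsd : psd K.
  move=> m s d; have := psd_fin (fun p : 'I_m * 'I_n => (((x p.2).1 * (s p.1 : G))%g, (x p.2).2))
    (fun p => d p.1 * c p.2) kpsd.
  congr (_ <= _).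
  rewrite -(pair_bigA _ (fun a i => \sum_(q : 'I_m * 'I_n) conjC (d a * c i) * (d q.1 * c q.2) *
     k (x i).2 (x q.2).2 ((x i).1 * (s a : G))%g ((x q.2).1 * (s q.1 : G))%g))/=.
  apply: eq_bigr => a _; under [RHS]eq_bigr do rewrite /K big_distrr/=.
  rewrite [RHS]exchange_big/=; apply: eq_bigr => i _.
  rewrite -(pair_bigA _ (fun b j => conjC (d a * c i) * (d b * c j) *
     k (x i).2 (x j).2 ((x i).1 * (s a : G))%g ((x j).1 * (s b : G))%g))/=.
  apply: eq_bigr => b _; rewrite big_distrr/=; apply: eq_bigr => j _.
  by rewrite rmorphM/=; ring.
have := cint_psd P Kpsd Kb; congr (_ <= _).
have b1 i j := bounded_meas_cint P P (bi i j).
transitivity (cint P (fun s => \sum_i \sum_j cint P (fun t => conjC (c i) * c j *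
    k (x i).2 (x j).2 ((x i).1 * (s : G))%g ((x j).1 * (t : G))%g))).
  congr (cint P _); apply/funext => s; rewrite cint_sum; last first.
    by move=> i; apply: bounded_meas_sum => j; exact: (bounded_meas_section1 (bi i j) s).
  apply: eq_bigr => i _; rewrite cint_sum// => j; exact: (bounded_meas_section1 (bi i j) s).
rewrite cint_sum; last by move=> i; apply: bounded_meas_sum => j; exact: b1.
apply: eq_bigr => i _; rewrite cint_sum; last by move=> j; exact: b1.
apply: eq_bigr => j _; rewrite /smooth -cintZ; last first.
  exact: (bounded_meas_cint P P (bounded_meas2_shift (x i).1 (x j).1 (bk _ _))).
congr (cint P _); apply/funext => s; rewrite cintZ//.
exact: (bounded_meas_section1 (bounded_meas2_shift (x i).1 (x j).1 (bk _ _)) s).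
Qed.

End smoothing.

(** * Kernels and Herz-Schur multipliers *)

Lemma lcsc_dense_sequence (G : lcscGroupType) : exists p : nat -> G,
  forall (x : G) U, nbhs x U -> exists n, U (p n).
Proof.
have [b [_ nb]] := second_countable_basis (@lcsc_second_countable G).
exists (fun n => get (b n)) => x U /nb[n [bnx bnU]]; exists n.
by apply: bnU; apply: getI bnx.
Qed.

Section kernel_representation.
Context (R : realType) (G : lcscGroupType).
Variable K : G * bool -> G * bool -> R[i].
Hypothesis K_psd : psd K.
Hypothesis K_cont : forall (g : G) (e : R), 0 < e ->
  \forall g' \near g, forall a q, cabs (K (g, a) q - K (g', a) q) <= e.

Lemma kernel_dist2 (g : G) (e : R) : 0 < e ->
  \forall g' \near g, forall a, dist2 K (g, a) (g', a) < e.
Proof.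
move=> e0; have e4 : 0 < e / 4 by rewrite divr_gt0.
apply: filterS (K_cont g e4) => g' H a; rewrite /dist2.
have H1 := H a (g, a); have H2 := H a (g', a).
have -> : K (g, a) (g, a) - K (g, a) (g', a) - K (g', a) (g, a) + K (g', a) (g', a) =
  (K (g, a) (g, a) - K (g', a) (g, a)) - (K (g, a) (g', a) - K (g', a) (g', a)) by ring.
rewrite raddfB/=; set u := K (g, a) (g, a) - _ in H1 *; set v := K (g, a) (g', a) - _ in H2 *.
have := le_trans (normr_Re_le u) H1; have := le_trans (normr_Re_le v) H2.
rewrite !ler_norml => /andP[h1 h2] /andP[h3 h4]; lra.
Qed.

(** Pivots are taken along a dense sequence of G * bool, which the parity of n makes
    alternate between the two copies of G. Continuity of the features is continuity of
    dist2. *)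
Lemma kernel_representation : exists (xi : bool -> G -> l2_hilbert R),
  [/\ forall a, continuous (xi a),
      forall a g, hnorm (xi a g) ^+ 2 = complex.Re (K (g, a) (g, a)) &
      forall a b g h, inner (l2_hilbert R) (xi a g) (xi b h) = K (g, a) (h, b)].
Proof.
have [p pdense] := lcsc_dense_sequence G.
pose q n : G * bool := (p n./2, odd n).
have qdense u e : 0 < e -> exists n, dist2 K u (q n) < e.
  case: u => g a e0; have [n Hn] := pdense _ _ (kernel_dist2 g e0).
  exists (a + n.*2)%N; rewrite /q half_bit_double oddD odd_double addbF oddb.
  exact: Hn.
pose xi a g : l2_hilbert R := feature q K_psd (g, a).
have E a b g h : inner (l2_hilbert R) (xi a g) (xi b h) = K (g, a) (h, b).
  exact: feature_dot.
have N a g : hnorm (xi a g) ^+ 2 = complex.Re (K (g, a) (g, a)).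
  by rewrite -E hnorm_sq.
exists xi; split => // a; apply/continuous_hnormP => g e e0.
have e2 : 0 < e ^+ 2 by rewrite exprn_gt0.
apply: filterS (kernel_dist2 g e2) => g' /(_ a) H.
rewrite -(@ltr_pXn2r _ 2)// ?nnegrE ?hnorm_ge0 ?ltW//.
rewrite (_ : hnorm _ ^+ 2 = dist2 K (g, a) (g', a))//.
rewrite /dist2 -!E.
have -> : inner (l2_hilbert R) (xi a g) (xi a g) - inner (l2_hilbert R) (xi a g) (xi a g') -
    inner (l2_hilbert R) (xi a g') (xi a g) + inner (l2_hilbert R) (xi a g') (xi a g') =
    inner (l2_hilbert R) (xi a g - xi a g') (xi a g - xi a g').
  by rewrite linearBl !linearBr /=; ring.
by rewrite hnorm_sq.
Qed.

(** The off-diagonal block of K is u, and the diagonal blocks bound the two maps that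
    represent it. *)
Lemma kernel_herz_schur (u : G -> R[i]^o) (m : bool -> R) : continuous u ->
  (forall g h, u (g^-1 * h)%g = K (g, false) (h, true)) ->
  (forall a, 0 <= m a) ->
  (forall a g, complex.Re (K (g, a) (g, a)) <= m a ^+ 2) ->
  herz_schur_multiplier u /\ herz_schur_norm u <= m false * m true.
Proof.
move=> cu uK m0 Km; have [xi [cxi Nxi Exi]] := kernel_representation.
have xim a g : hnorm (xi a g) <= m a.
  by rewrite -(@ler_pXn2r _ 2)// ?nnegrE ?hnorm_ge0// Nxi.
have rep : herz_schur_representation u (xi false) (xi true).
  by split; [split => //; exists (m false)|split => //; exists (m true)|move=> g h; rewrite Exi uK].
split; first by split => //; exists (l2_hilbert R), (xi false), (xi true).
have sup_le a : sup (range (fun g => hnorm (xi a g))) <= m a.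
  by apply: ge_sup; [exists (hnorm (xi a 1%g)), 1%g|move=> _ [g _ <-]].
have sup_ge0 (V : hilbertSpace R) (z : G -> V) : bounded_continuous z ->
    0 <= sup (range (fun g => hnorm (z g))).
  move=> [_ [M zM]]; apply: (@le_trans _ _ (hnorm (z 1%g))); first exact: hnorm_ge0.
  by apply: ub_le_sup; [exists M => _ [g _ <-]|exists 1%g].
apply: (@le_trans _ _ (sup (range (fun g => hnorm (xi false g))) * sup (range (fun g => hnorm (xi true g))))).
  apply: ge_inf; last by exists (l2_hilbert R), (xi false), (xi true).
  exists 0 => _ [V [z [w [[bz bw _] ->]]]].
  by rewrite mulr_ge0// sup_ge0.
have [bx by' _] := rep.
by rewrite ler_pM ?sup_ge0.
Qed.

End kernel_representation.

(** The norm is an infimum, whence the loss of 1. *)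
Lemma herz_schur_near_optimal (R : realType) (H : lcscGroupType) (phi : H -> R[i]^o) (C : R) :
  herz_schur_multiplier phi -> herz_schur_norm phi <= C ->
  exists (V : hilbertSpace R) (z : bool -> H -> V) (m : bool -> R),
  [/\ forall a, continuous (z a), forall a, 0 <= m a, forall a h, hnorm (z a h) <= m a,
      forall g h, phi (g^-1 * h)%g = inner V (z false g) (z true h) &
      m false * m true <= C + 1].
Proof.
move=> [_ [V0 [xi0 [eta0 rep0]]]] phiC.
have sup_ge (V : hilbertSpace R) (z : H -> V) h : bounded_continuous z ->
    hnorm (z h) <= sup (range (fun g => hnorm (z g))).
  by move=> [_ [M zM]]; apply: ub_le_sup; [exists M => _ [g _ <-]|exists h].
rewrite /herz_schur_norm in phiC; set S := [set c | _] in phiC.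
have hS : has_inf S.
  split.
    by exists (sup (range (fun g => hnorm (xi0 g))) * sup (range (fun g => hnorm (eta0 g)))), V0, xi0, eta0.
  exists 0 => _ [V [z [w [[bz bw _] ->]]]].
  by apply: mulr_ge0; [exact: le_trans (hnorm_ge0 (z 1%g)) (sup_ge _ _ _ bz)
                      |exact: le_trans (hnorm_ge0 (w 1%g)) (sup_ge _ _ _ bw)].
have [_ [V [xi [eta [rep ->]]]] lt] := inf_adherent ltr01 hS.
have [bx be phiE] := rep.
have [[cx _] [ce _]] := (bx, be).
exists V, (fun a => if a then eta else xi),
  (fun a => if a then sup (range (fun g => hnorm (eta g))) else sup (range (fun g => hnorm (xi g)))).
split => //.
- by case.
- by case; [exact: le_trans (hnorm_ge0 (eta 1%g)) (sup_ge _ _ _ be)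
           |exact: le_trans (hnorm_ge0 (xi 1%g)) (sup_ge _ _ _ bx)].
- by case=> h; exact: sup_ge.
- by apply: (le_trans (ltW lt)); rewrite lerD2r.
Qed.

Lemma cvg_to_1P (R : realType) (G : lcscGroupType) (phi : nat -> G -> R[i]^o) :
  cvg_to_1_on_compacts phi <->
  forall K : set G, compact K -> forall e : R, 0 < e ->
    \forall n \near \oo, forall g, K g -> cabs ((phi n g : R[i]) - 1) < e.
Proof.
rewrite /cvg_to_1_on_compacts; split.
  move=> /fam_cvgP H K cK e e0.
  have e0' : 0 < e%:C%C :> R[i] by rewrite ltcR.
  have := H K cK [set h : G -> R[i]^o | forall g, K g -> cabs ((h g : R[i]) - 1) < e].
  apply; apply/uniform_nbhs.
  exists [set p : R[i]^o * R[i]^o | ball p.1 e%:C%C p.2]; split.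
    exact: (entourage_ball _ (PosNum e0')).
  move=> h Hh g Kg; have := Hh g Kg.
  by rewrite /= -ball_normE /= ltc_cabs// -cabsN opprB.
move=> H; apply/fam_cvgP => K cK P /uniform_nbhs[E [+ EP]].
rewrite -entourage_ballE => -[e /= e0 sE].
have e0' : 0 < complex.Re e by case: e e0 {sE} => a b; rewrite ltcE => /andP[].
apply: filterS (H K cK _ e0') => n Hn; apply: EP => g Kg; apply: sE.
by rewrite /= -ball_normE /= (ltc_cabs _ e0) -cabsN opprB; exact: Hn.
Qed.

(** * Kernels pulled back along a cocycle *)

Definition cindic (R : realType) (T : Type) (W : set T) (x : T) : R[i] := (\1_W x : R)%:C%C.

Section cindic.
Context (R : realType) (T : Type).
Implicit Type W : set T.

Lemma cabs_cindic_le W x : cabs (cindic R W x) <= 1.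
Proof. by rewrite cabs_real indicE; case: (_ \in _); rewrite ?normr1 ?normr0 ?ler01. Qed.

Lemma conj_cindic W x : conjC (cindic R W x) = cindic R W x.
Proof. by rewrite conjCE conjc_real. Qed.

Lemma cindicT x : cindic R [set: T] x = 1.
Proof. by rewrite /cindic indicT rmorph1. Qed.

Lemma cindic1 W x : W x -> cindic R W x = 1.
Proof. by move=> Wx; rewrite /cindic indicE mem_set. Qed.

Lemma cindic0 W x : ~ W x -> cindic R W x = 0.
Proof. by move=> Wx; rewrite /cindic indicE memNset. Qed.

End cindic.

Lemma bounded_meas_cindic (R : realType) d (T : measurableType d) (W : set T) :
  measurable W -> bounded_meas (cindic R W).
Proof.
move=> mW; split; last by exists 1 => x; exact: cabs_cindic_le.
- exact: measurable_indic.
- exact: measurable_cst.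
Qed.

Lemma cabs_cint_le_on (R : realType) d (T : measurableType d) (P : probability T R)
    (f : T -> R[i]) (A : set T) (e : R) : measurable A -> bounded_meas f -> 0 <= e ->
  P (~` A) = 0%E -> (forall x, A x -> cabs (f x) <= e) -> cabs (cint P f) <= 2 * e.
Proof.
move=> mA bf e0 A0 fe.
have bg : bounded_meas (fun x => cindic R A x * f x).
  by apply: bounded_measM => //; exact: bounded_meas_cindic.
rewrite (@cint_ae _ _ _ P f (fun x => cindic R A x * f x))//.
  apply: cabs_cint_le => // x; have [Ax|Ax] := pselect (A x).
    by rewrite cindic1// mul1r fe.
  by rewrite cindic0// mul0r cabs0.
exists (~` A); split => //; first exact: measurableC.
by move=> x /= nx Ax; apply: nx; rewrite cindic1 ?mul1r.
Qed.

Section smooth_estimates.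
Context (R : realType) (G : lcscGroupType) (P : probability (borel G) R).

Lemma smooth_small (U : set G) (k : G -> G -> R[i]) (g h : G) (e : R) :
  compact U -> P (~` (U : set (borel G))) = 0%E -> bounded_meas2 k -> 0 <= e ->
  (forall s t, U s -> U t -> cabs (k (g * s)%g (h * t)%g) <= e) ->
  cabs (smooth P k g h) <= 4 * e.
Proof.
move=> /measurable_compactg mU PU bk e0 ke; have bs := bounded_meas2_shift g h bk.
have -> : 4 * e = 2 * (2 * e) by ring.
apply: (cabs_cint_le_on mU) => //; first exact: (bounded_meas_cint P P bs).
  by rewrite mulr_ge0.
move=> s Us; apply: (cabs_cint_le_on mU) => //; first exact: (bounded_meas_section1 bs).
by move=> t Ut; exact: ke.
Qed.

Lemma smooth_cvg (k : nat -> G -> G -> R[i]) (l : R[i]) (M : R) (g h : G) :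
  (forall n, bounded_meas2 (k n)) -> (forall n s t, cabs (k n s t) <= M) ->
  (forall s t, (fun n => cabs (k n s t - l)) @ \oo --> (0 : R)) ->
  (fun n => cabs (smooth P (k n) g h - l)) @ \oo --> (0 : R).
Proof.
move=> bk kM kl; have bs n := bounded_meas2_shift g h (bk n).
apply: (@cint_cvg _ _ _ P _ l (2 * M)).
- by move=> n; exact: (bounded_meas_cint P P (bs n)).
- move=> n s; apply: cabs_cint_le => //; exact: (bounded_meas_section1 (bs n)).
- apply: aeW => s; apply: (@cint_cvg _ _ _ P _ l M) => //.
    by move=> n; exact: (bounded_meas_section1 (bs n)).
  by apply: aeW => t; exact: kl.
Qed.

End smooth_estimates.

Section cocycle_kernel.
Context (R : realType) (G H : lcscGroupType) dX (X : measurableType dX) (mu : probability X R).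
Variables (actX : G -> X -> X) (omega : G * X -> H) (P : probability (borel G) R).
Hypotheses (act1 : forall x, actX 1%g x = x)
  (actM : forall g h x, actX (g * h)%g x = actX g (actX h x))
  (m_act : measurable_fun setT (fun p : borel G * X => actX p.1 p.2))
  (m_omega : measurable_fun setT (omega : borel G * X -> borel H))
  (cocycle : forall g k : G, \forall x \ae mu,
     omega ((g * k)%g, x) = (omega (g, actX k x) * omega (k, x))%g)
  (invariant : forall g A, measurable A -> mu (actX g @^-1` A) = mu A).

Lemma measurable_act d (T : measurableType d) (c : T -> borel G) (x : T -> X) :
  measurable_fun setT c -> measurable_fun setT x ->
  measurable_fun setT (fun p => actX (c p) (x p)).
Proof.
move=> mc mx; have mp : measurable_fun setT (fun p => (c p, x p)) by exact: measurable_fun_pair.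
exact: (measurableT_comp m_act mp).
Qed.

Lemma measurable_cocycle d (T : measurableType d) (c : T -> borel G) (x : T -> X) :
  measurable_fun setT c -> measurable_fun setT x ->
  measurable_fun setT (fun p => omega (c p, x p) : borel H).
Proof.
move=> mc mx; have mp : measurable_fun setT (fun p => (c p, x p)) by exact: measurable_fun_pair.
exact: (measurableT_comp m_omega mp).
Qed.

Lemma measurable_act1 g : measurable_fun setT (actX g).
Proof. by apply: (@measurable_act _ _ (fun=> g) id); [exact: measurable_cst|exact: measurable_id]. Qed.

(** The integral of phi along the cocycle. The set W restricts to points x with x and r x
    in W, where properness of the cocycle takes effect. *)
Definition integrated (W : set X) (phi : H -> R[i]) (r : G) : R[i] :=
  cint mu (fun x => cindic R W x * cindic R W (actX r x) * phi (omega (r, x))).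

(** Writing y = t x turns the integral at r = s^-1 t into one whose integrand is, for each
    y, a kernel F at points depending on s and on t separately; so positivity passes from F
    to the integral. *)
Definition cocycle_kernel (W : set X) (F : H -> H -> R[i]) (s t : G) : R[i] :=
  cint mu (fun y => cindic R W (actX s^-1%g y) * cindic R W (actX t^-1%g y) *
    F (omega (s^-1%g, y))^-1%g (omega (t^-1%g, y))^-1%g).

Section fixed_set.
Variable W : set X.
Hypothesis mW : measurable W.

Lemma bounded_meas_integrand (phi : H -> R[i]) (r : G) :
  bounded_meas (phi : borel H -> R[i]) ->
  bounded_meas (fun x => cindic R W x * cindic R W (actX r x) * phi (omega (r, x))).
Proof.
move=> bphi; apply: bounded_measM; first apply: bounded_measM.
- exact: bounded_meas_cindic.
- exact: (bounded_meas_comp (measurable_act1 r) (bounded_meas_cindic R mW)).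
- apply: (bounded_meas_comp (h := fun x => omega (r, x) : borel H) _ bphi).
  by apply: (@measurable_cocycle _ _ (fun=> r) id); [exact: measurable_cst|exact: measurable_id].
Qed.

Lemma bounded_meas_kernel_integrand (F : H -> H -> R[i]) : bounded_meas2 F ->
  bounded_meas (fun p : (borel G * borel G) * X =>
    cindic R W (actX (p.1.1 : G)^-1%g p.2) * cindic R W (actX (p.1.2 : G)^-1%g p.2) *
    F (omega ((p.1.1 : G)^-1%g, p.2))^-1%g (omega ((p.1.2 : G)^-1%g, p.2))^-1%g).
Proof.
move=> bF.
have m1 : measurable_fun setT (fun p : (borel G * borel G) * X => (p.1.1 : G)^-1%g : borel G).
  exact: (measurableT_comp (@measurable_invg G) (measurableT_comp measurable_fst measurable_fst)).
have m2 : measurable_fun setT (fun p : (borel G * borel G) * X => (p.1.2 : G)^-1%g : borel G).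
  exact: (measurableT_comp (@measurable_invg G) (measurableT_comp measurable_snd measurable_fst)).
have m3 := @measurable_snd _ _ (borel G * borel G)%type X.
apply: bounded_measM; first apply: bounded_measM.
- exact: (bounded_meas_comp (measurable_act m1 m3) (bounded_meas_cindic R mW)).
- exact: (bounded_meas_comp (measurable_act m2 m3) (bounded_meas_cindic R mW)).
- apply: (bounded_meas2_comp bF).
  + exact: (measurableT_comp (@measurable_invg H) (measurable_cocycle m1 m3)).
  + exact: (measurableT_comp (@measurable_invg H) (measurable_cocycle m2 m3)).
Qed.

Lemma cocycle_kernel_meas (F : H -> H -> R[i]) : bounded_meas2 F ->
  bounded_meas2 (cocycle_kernel W F).
Proof.
move=> /bounded_meas_kernel_integrand b.
have := bounded_meas_cint (P \x P)%E mu b.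
by congr bounded_meas; apply/funext => -[s t].
Qed.

Lemma cabs_cindicM_le (z : R[i]) x y M : cabs z <= M ->
  cabs (cindic R W x * cindic R W y * z) <= M.
Proof.
move=> zM; rewrite !cabsM -[leRHS]mul1r; apply: ler_pM; rewrite ?mulr_ge0 ?cabs_ge0//.
by rewrite -[leRHS]mul1r; apply: ler_pM; rewrite ?cabs_ge0 ?cabs_cindic_le.
Qed.

Lemma cocycle_kernel_le (F : H -> H -> R[i]) M s t : bounded_meas2 F ->
  (forall h h', cabs (F h h') <= M) -> cabs (cocycle_kernel W F s t) <= 2 * M.
Proof.
move=> /bounded_meas_kernel_integrand b FM; apply: cabs_cint_le.
  exact: (bounded_meas_section1 b (s, t)).
by move=> y; exact: cabs_cindicM_le.
Qed.

Lemma cocycle_kernel_psd (I : Type) (F : I -> I -> H -> H -> R[i]) :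
  (forall a b, bounded_meas2 (F a b)) ->
  psd (fun p q : H * I => F p.2 q.2 p.1 q.1) ->
  psd (fun p q : G * I => cocycle_kernel W (F p.2 q.2) p.1 q.1).
Proof.
move=> bF Fpsd n x c.
have b i j := bounded_meas_section1
  (bounded_meas_kernel_integrand (bF (x i).2 (x j).2)) ((x i).1, (x j).1).
have -> : \sum_i \sum_j conjC (c i) * c j * cocycle_kernel W (F (x i).2 (x j).2) (x i).1 (x j).1 =
  cint mu (fun y => \sum_i \sum_j conjC (c i) * c j *
    (cindic R W (actX (x i).1^-1%g y) * cindic R W (actX (x j).1^-1%g y) *
     F (x i).2 (x j).2 (omega ((x i).1^-1%g, y))^-1%g (omega ((x j).1^-1%g, y))^-1%g)).
  rewrite cint_sum; last by move=> i; apply: bounded_meas_sum => j; exact: bounded_measZ (b i j).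
  apply: eq_bigr => i _; rewrite cint_sum; last by move=> j; exact: bounded_measZ (b i j).
  by apply: eq_bigr => j _; rewrite cintZ//; exact: b i j.
apply: cint_ge0 => y.
have := Fpsd n (fun i => ((omega ((x i).1^-1%g, y))^-1%g, (x i).2))
  (fun i => c i * cindic R W (actX (x i).1^-1%g y)).
congr (_ <= _); apply: eq_bigr => i _; apply: eq_bigr => j _ /=.
by rewrite rmorphM/= conj_cindic; ring.
Qed.

(** Invariance of mu under t, then the cocycle identity for s^-1 * t, for t^-1 * t and for
    1 * 1. *)
Lemma cocycle_kernel_integrated (F : H -> H -> R[i]) (phi : H -> R[i]) s t :
  bounded_meas2 F -> bounded_meas (phi : borel H -> R[i]) ->
  (forall h h', F h h' = phi (h^-1 * h')%g) ->
  cocycle_kernel W F s t = integrated W phi (s^-1 * t)%g.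
Proof.
move=> bF bphi Fphi.
have b := bounded_meas_section1 (bounded_meas_kernel_integrand bF) (s, t).
rewrite /cocycle_kernel -(cint_invariant (measurable_act1 t) (@invariant t) b) /=.
apply: cint_ae.
- exact: (bounded_meas_comp (measurable_act1 t) b).
- exact: bounded_meas_integrand.
have c1 := cocycle s^-1%g t; have c2 := cocycle t^-1%g t; have c3 := cocycle 1%g 1%g.
apply: filterS3 c1 c2 c3 => x E1 E2 E3.
rewrite Fphi invgK -!actM mulVg act1 E1.
have o1 : omega (1%g, x) = 1%g.
  move: E3; rewrite act1 mulg1 => /(congr1 (fun z => (z * (omega (1%g, x))^-1)%g)).
  by rewrite mulgV mulgK => <-.
have -> : (omega (t^-1%g, actX t x))^-1%g = omega (t, x).
  by move: E2; rewrite mulVg o1 => /esym/mulg1_eq.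
by rewrite [cindic R W (actX _ x) * _]mulrC.
Qed.

(** Only points with omega (r, x) outside L contribute. *)
Lemma integrated_small (phi : H -> R[i]) (L : set H) (e : R) (r : G) :
  compact L -> bounded_meas (phi : borel H -> R[i]) -> 0 <= e ->
  (forall h, ~ L h -> cabs (phi h) <= e) ->
  (\forall x \ae mu, ~ (W x /\ W (actX r x) /\ L (omega (r, x)))) ->
  cabs (integrated W phi r) <= 2 * e.
Proof.
move=> /measurable_compactg mL b e0 phie [N [mN N0 sN]].
apply: (cabs_cint_le_on (measurableC mN)) => //.
- exact: bounded_meas_integrand.
- by rewrite setCK.
move=> x nNx; have nx : ~ (W x /\ W (actX r x) /\ L (omega (r, x))).
  by apply: contrapT => h; apply: nNx; exact: sN.
have [Wx|Wx] := pselect (W x); last by rewrite cindic0// !mul0r cabs0.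
have [Wrx|Wrx] := pselect (W (actX r x)); last by rewrite (cindic0 R Wrx) mulr0 mul0r cabs0.
by rewrite !cindic1// !mul1r; apply: phie => h; exact: nx.
Qed.

End fixed_set.

(** The integrands differ only where x or r x is outside W, and by invariance these two
    sets have the same measure. *)
Lemma integrated_cut (W : set X) (phi : H -> R[i]) (M : R) (r : G) : measurable W ->
  bounded_meas (phi : borel H -> R[i]) -> (forall h, cabs (phi h) <= M) ->
  cabs (integrated W phi r - integrated setT phi r) <= 4 * M * fine (mu (~` W)).
Proof.
move=> mW b phiM; have M0 : 0 <= M by exact: le_trans (cabs_ge0 _) (phiM 1%g).
have bW := bounded_meas_integrand mW r b; have bT := bounded_meas_integrand measurableT r b.
have mC := measurableC mW.
have mCr : measurable (actX r @^-1` (~` W)).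
  by rewrite -[X in measurable X]setTI; exact: (measurable_act1 r).
have iI (A : set X) : measurable A -> mu.-integrable setT (EFin \o (\1_A : X -> R)).
  move=> mA; apply: (@bounded_integrable _ _ _ _ _ 1); first exact: measurable_indic.
  by move=> x; rewrite indicE; case: (_ \in _); rewrite ?normr1 ?normr0 ?ler01.
have II (A : set X) : measurable A -> \int[mu]_x (\1_A x) = fine (mu A).
  by move=> mA; rewrite /Rintegral integral_indic// setIT.
rewrite /integrated -[X in X - _]addr0 -mulN1r -cintZ// addr0 -cintD//; last exact: bounded_measZ.
apply: (le_trans (cabs_cint_le_int _ _)); first by apply: bounded_measD => //; exact: bounded_measZ.
have -> : 4 * M * fine (mu (~` W)) = 2 * (M * (fine (mu (~` W)) + fine (mu (actX r @^-1` (~` W))))).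
  by rewrite invariant//; ring.
rewrite ler_pM2l//.
have -> : M * (fine (mu (~` W)) + fine (mu (actX r @^-1` (~` W)))) =
    \int[mu]_x (M * (\1_(~` W) x + \1_(actX r @^-1` (~` W)) x)).
  rewrite RintegralZl//; last first.
    have := integrableD measurableT (iI _ mC) (iI _ mCr).
    by congr (_.-integrable _ _).
  by rewrite RintegralD// ?II//; exact: iI.
apply: le_Rintegral => //.
- apply: (@bounded_integrable _ _ _ _ _ (M + M)).
    by apply: measurable_cabs; apply: bounded_measD => //; exact: bounded_measZ.
  move=> x; rewrite ger0_norm ?cabs_ge0// mulN1r (le_trans (cabsB _ _))//.
  by apply: lerD; exact: cabs_cindicM_le.
- have := integrableZl measurableT M (integrableD measurableT (iI _ mC) (iI _ mCr)).
  by congr (_.-integrable _ _).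
move=> x _; rewrite !cindicT !mul1r mulN1r.
have [Wx|Wx] := pselect (W x); have [Wrx|Wrx] := pselect (W (actX r x)).
- rewrite !cindic1// !mul1r subrr cabs0 mulr_ge0// addr_ge0// indicE ler0n.
- rewrite (cindic0 R Wrx) mulr0 mul0r sub0r cabsN.
  rewrite [X in _ + X]indicE (_ : x \in _) ?inE// -[leLHS]mulr1; apply: ler_pM; rewrite ?cabs_ge0//.
  by rewrite lerDr indicE ler0n.
- rewrite (cindic0 R Wx) !mul0r sub0r cabsN.
  rewrite [X in X + _]indicE (_ : x \in _) ?inE// -[leLHS]mulr1; apply: ler_pM; rewrite ?cabs_ge0//.
  by rewrite lerDl indicE ler0n.
- rewrite (cindic0 R Wx) !mul0r sub0r cabsN.
  rewrite [X in X + _]indicE (_ : x \in _) ?inE// -[leLHS]mulr1; apply: ler_pM; rewrite ?cabs_ge0//.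
  by rewrite lerDl indicE ler0n.
Qed.

(** Dominated convergence on X, after removing the cut. *)
Lemma integrated_cvg (W : nat -> set X) (phi : nat -> H -> R[i]) (M : R) (r : G) :
  (forall n, measurable (W n)) ->
  (fun n => fine (mu (~` W n))) @ \oo --> (0 : R) ->
  (forall n, bounded_meas (phi n : borel H -> R[i])) -> (forall n h, cabs (phi n h) <= M) ->
  (forall h, (fun n => cabs (phi n h - 1)) @ \oo --> (0 : R)) ->
  (fun n => cabs (integrated (W n) (phi n) r - 1)) @ \oo --> (0 : R).
Proof.
move=> mW W0 b phiM phi1.
have H1 : (fun n => cabs (integrated setT (phi n) r - 1)) @ \oo --> (0 : R).
  apply: (@cint_cvg _ _ _ mu _ 1 M).
  - by move=> n; exact: bounded_meas_integrand.
  - by move=> n x; exact: cabs_cindicM_le.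
  - by apply: aeW => x; under eq_fun do rewrite !cindicT !mul1r; exact: phi1.
have H2 : (fun n => 4 * M * fine (mu (~` W n)) + cabs (integrated setT (phi n) r - 1)) @ \oo --> (0 : R).
  rewrite -[X in _ --> X](addr0 (0 : R)); apply: cvgD => //.
  by rewrite -(mulr0 (4 * M)); exact: cvgMr.
apply: (@squeeze_cvgr _ _ _ _ (cst 0) _) H2 => //; last exact: cvg_cst.
apply: nearW => n; rewrite cabs_ge0 /=.
have -> : integrated (W n) (phi n) r - 1 = (integrated (W n) (phi n) r - integrated setT (phi n) r) +
  (integrated setT (phi n) r - 1) by ring.
by rewrite (le_trans (cabsD _ _))// lerD2r; exact: integrated_cut.
Qed.

End cocycle_kernel.

(** * Transfer of multipliers *)

(** Carries a Herz-Schur multiplier in the form that survives integration: phi is the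
    off-diagonal block of a positive semidefinite 2 by 2 matrix of kernels, whose diagonal
    blocks bound the norm. For positive type phi all four blocks are equal. *)
Definition multiplier_kernel (R : realType) (H : lcscGroupType) (phi : H -> R[i]^o)
    (F : bool -> bool -> H -> H -> R[i]) (m : bool -> R) : Prop :=
  [/\ psd (fun p q : H * bool => F p.2 q.2 p.1 q.1),
      forall a b, bounded_meas2 (F a b),
      forall a b h h', cabs (F a b h h') <= m a * m b,
      forall h h', F false true h h' = phi (h^-1 * h')%g &
      forall a, 0 <= m a].

Section multiplier_kernel.
Context (R : realType) (H : lcscGroupType) (phi : H -> R[i]^o).

Lemma herz_schur_multiplier_kernel (C : R) :
  herz_schur_multiplier phi -> herz_schur_norm phi <= C ->
  exists F m, multiplier_kernel phi F m /\ m false * m true <= C + 1.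
Proof.
move=> phiHS phiC; have [V [z [m [cz m0 zm zphi mC]]]] := herz_schur_near_optimal phiHS phiC.
exists (fun a b h h' => inner V (z a h) (z b h')), m; split => //; split => //.
- by move=> n x c; exact: (inner_psd (fun i => z (x i).2 (x i).1) c).
- move=> a b; apply: (@bounded_meas_continuous2 _ _ _ _ (m a * m b)).
  + exact: lcsc_second_countable.
  + exact: lcsc_second_countable.
  + exact: (continuous_inner (cz a) (cz b) (zm a) (zm b)).
  + by move=> -[h h'] /=; rewrite (le_trans (inner_CS _ _))// ler_pM// hnorm_ge0.
- by move=> a b h h'; rewrite (le_trans (inner_CS _ _))// ler_pM// hnorm_ge0.
Qed.

Lemma psd_positive_type S (K : S -> S -> R[i]) (s : H -> S) : psd K ->
  (forall g h, phi (g^-1 * h)%g = K (s g) (s h)) -> positive_type phi.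
Proof.
move=> K0 phiK n g c; have := K0 n (s \o g) c.
by under eq_bigr do under eq_bigr do rewrite /= -phiK.
Qed.

Lemma positive_type_psd : positive_type phi -> psd (fun h h' : H => phi (h^-1 * h')%g : R[i]).
Proof. by move=> H0 n s c; exact: H0. Qed.

Lemma positive_type_le h : positive_type phi -> cabs (phi h) <= complex.Re (phi 1%g).
Proof.
move=> /positive_type_psd phi0.
have := psd_CS 1%g h phi0; have [_] := psd_diag 1%g phi0.
rewrite invg1 !mul1g mulVg => p0; rewrite -expr2 => H1.
by rewrite -[leRHS]ger0_norm// -sqrtr_sqr /cabs ler_wsqrtr.
Qed.

Lemma positive_type_multiplier_kernel : continuous phi -> positive_type phi ->
  multiplier_kernel phi (fun _ _ h h' => phi (h^-1 * h')%g)
    (fun=> Num.sqrt (complex.Re (phi 1%g))).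
Proof.
move=> cphi phi0; have le h := positive_type_le h phi0.
have p0 : 0 <= complex.Re (phi 1%g) by exact: le_trans (cabs_ge0 _) (le 1%g).
split => //.
- move=> _ _; apply: (@bounded_meas_continuous2 _ _ _
    (fun p : H * H => phi (p.1^-1 * p.2)%g) (complex.Re (phi 1%g))).
  + exact: lcsc_second_countable.
  + exact: lcsc_second_countable.
  + move=> x; apply: (@continuous_comp _ _ _ (fun p : H * H => (p.1^-1 * p.2)%g) phi); last exact: cphi.
    apply: continuousMg; last by move=> y; exact: cvg_snd.
    by apply: continuousVg => y; exact: cvg_fst.
  + by move=> x; exact: le.
- by move=> _ _ h h'; rewrite -expr2 sqr_sqrtr.
Qed.

End multiplier_kernel.

Section transfer.
Context (R : realType) (G H : lcscGroupType) dX (X : measurableType dX) (mu : probability X R).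
Variables (actX : G -> X -> X) (omega : G * X -> H) (P : probability (borel G) R) (U : set G).
Hypotheses (act1 : forall x, actX 1%g x = x)
  (actM : forall g h x, actX (g * h)%g x = actX g (actX h x))
  (m_act : measurable_fun setT (fun p : borel G * X => actX p.1 p.2))
  (m_omega : measurable_fun setT (omega : borel G * X -> borel H))
  (cocycle : forall g k : G, \forall x \ae mu,
     omega ((g * k)%g, x) = (omega (g, actX k x) * omega (k, x))%g)
  (invariant : forall g A, measurable A -> mu (actX g @^-1` A) = mu A)
  (U_compact : compact U) (PU : P (~` (U : set (borel G))) = 0%E)
  (P_continuous : translation_continuous P).

Local Notation kern := (cocycle_kernel mu actX omega).
Local Notation integrated := (integrated mu actX omega).

(** The kernel on G is not obviously continuous; smoothing it over U costs a constant
    factor and yields continuity as well as uniform convergence on compact sets. *)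
Definition transferred (W : set X) (F : H -> H -> R[i]) (g : G) : R[i]^o :=
  smooth P (kern W F) 1%g g.

Lemma multiplier_bounded_meas (phi : H -> R[i]^o) F m : continuous phi ->
  multiplier_kernel phi F m -> bounded_meas (phi : borel H -> R[i]) /\
  forall h, cabs (phi h) <= m false * m true.
Proof.
move=> cphi [_ _ Fm Fphi _].
have le h : cabs (phi h) <= m false * m true by have := Fm false true 1%g h; rewrite Fphi invg1 mul1g.
by split => //; exact: bounded_meas_continuous cphi le.
Qed.

Section fixed_multiplier.
Variables (W : set X) (phi : H -> R[i]^o) (F : bool -> bool -> H -> H -> R[i]) (m : bool -> R).
Hypotheses (mW : measurable W) (cphi : continuous phi) (FK : multiplier_kernel phi F m).

Let bF a b : bounded_meas2 (F a b). Proof. by have [_ + _ _ _] := FK; exact. Qed.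
Let bphi : bounded_meas (phi : borel H -> R[i]). Proof. exact: (multiplier_bounded_meas cphi FK).1. Qed.

Lemma kern_meas a b : bounded_meas2 (kern W (F a b)).
Proof. exact: (cocycle_kernel_meas mu P m_act m_omega mW (bF a b)). Qed.

Lemma kern_le a b s t : cabs (kern W (F a b) s t) <= 2 * (m a * m b).
Proof.
apply: (cocycle_kernel_le mu m_act m_omega mW _ _ (bF a b)).
by have [_ _ + _ _] := FK; exact.
Qed.

Lemma kern_integrated s t : kern W (F false true) s t = integrated W phi (s^-1 * t)%g.
Proof.
apply: (cocycle_kernel_integrated act1 actM m_act m_omega cocycle invariant mW _ _ (bF _ _) bphi).
by have [_ _ _ + _] := FK; exact.
Qed.

Definition transferred_kernel (p q : G * bool) : R[i] := smooth P (kern W (F p.2 q.2)) p.1 q.1.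

Lemma transferred_kernel_psd : psd transferred_kernel.
Proof.
apply: (smooth_psd P (k := fun a b => kern W (F a b))); first exact: kern_meas.
apply: (cocycle_kernel_psd mu m_act m_omega mW bF).
by have [+ _ _ _ _] := FK; exact.
Qed.

(** The pulled back kernel at (g s, h t) depends on s^-1 g^-1 h t only. *)
Lemma transferred_kernelE g h :
  transferred W (F false true) (g^-1 * h)%g = transferred_kernel (g, false) (h, true).
Proof.
rewrite /transferred /transferred_kernel /smooth.
apply: (congr1 (cint P)); apply/funext => s; apply: (congr1 (cint P)); apply/funext => t.
rewrite /= (kern_integrated (1 * (s : G))%g) (kern_integrated (g * (s : G))%g).
apply: congr1.
have E (a b c d : G) : ((1 * a)^-1 * (b^-1 * c * d) = (b * a)^-1 * (c * d))%g.
  by rewrite mul1g invgM !mulgA.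
exact: E.
Qed.

Lemma transferred_positive_type : F false true = F false false ->
  positive_type (transferred W (F false true)).
Proof.
move=> F0; apply: (psd_positive_type (s := fun g => (g, false)) transferred_kernel_psd).
by move=> g h; rewrite transferred_kernelE /transferred_kernel /= F0.
Qed.

Lemma transferred_kernel_diag a g :
  complex.Re (transferred_kernel (g, a) (g, a)) <= (3 * m a) ^+ 2.
Proof.
apply: (le_trans (ler_norm _)); apply: (le_trans (normr_Re_le _)).
apply: (le_trans (smooth_le P g g (kern_meas a a) (kern_le a a))).
have := sqr_ge0 (m a); rewrite !expr2; lra.
Qed.

Lemma transferred_kernel_continuous (g : G) (e : R) : 0 < e ->
  \forall g' \near g, forall a q,
    cabs (transferred_kernel (g, a) q - transferred_kernel (g', a) q) <= e.
Proof.
move=> e0; have [_ _ _ _ m0] := FK.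
pose B := 2 * ((m false + m true) * (m false + m true)).
have B0 : 0 <= B by rewrite !mulr_ge0// addr_ge0.
have kB a b s t : cabs (kern W (F a b) s t) <= B.
  apply: (le_trans (kern_le a b s t)); rewrite ler_pM2l//.
  by apply: ler_pM => //; case: a b => -[]; rewrite ?lerDl ?lerDr.
have e1 : 0 < e / (B + 1) by rewrite divr_gt0// ltr_wpDl.
apply: filterS (smooth_equicontinuous P_continuous g e1) => g' Hg' a [h b].
have [h1 _] := Hg' _ B (kern_meas a b) (kB a b) h.
apply: (le_trans h1).
by rewrite mulrAC ler_pdivrMr ?ltr_wpDl// ler_pM2l// lerDl.
Qed.

Lemma transferred_continuous : continuous (transferred W (F false true)).
Proof.
have [_ _ _ _ m0] := FK.
apply/continuous_cabsP => g e e0.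
have B0 : 0 <= 2 * (m false * m true) by rewrite !mulr_ge0.
have e1 : 0 < e / (2 * (m false * m true) + 1) by rewrite divr_gt0// ltr_wpDl.
apply: filterS (smooth_equicontinuous P_continuous g e1) => g' Hg'.
have [_ h1] := Hg' _ _ (kern_meas false true) (kern_le false true) 1%g.
apply: (le_lt_trans h1).
by rewrite mulrAC ltr_pdivrMr ?ltr_wpDl// ltr_pM2l// ltrDl.
Qed.

Lemma transferred_herz_schur :
  herz_schur_multiplier (transferred W (F false true)) /\
  herz_schur_norm (transferred W (F false true)) <= 9 * (m false * m true).
Proof.
have [_ _ _ _ m0] := FK.
have -> : 9 * (m false * m true) = (3 * m false) * (3 * m true) by ring.
apply: (kernel_herz_schur transferred_kernel_psd transferred_kernel_continuous
  (m := fun a => 3 * m a)) transferred_continuous transferred_kernelE _ transferred_kernel_diag.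
by move=> a; rewrite mulr_ge0.
Qed.

(** For s and t in U, if s^-1 g t is in Q then g is in U * Q * U^-1. *)
Lemma transferred_small (Q : set G) (e : R) : compact Q -> 0 <= e ->
  (forall r, ~ Q r -> cabs (integrated W phi r) <= e) ->
  exists2 Q' : set G, compact Q' &
    forall g, ~ Q' g -> cabs (transferred W (F false true) g) <= 4 * e.
Proof.
move=> cQ e0 Qe.
exists [set (p.1 * p.2)%g | p in [set (p.1 * p.2)%g | p in U `*` Q] `*` [set x^-1%g | x in U]].
  by apply: compact_mulg; [exact: compact_mulg|exact: compact_invg].
move=> g Qg; apply: (smooth_small U_compact PU (kern_meas _ _) e0) => s t Us Ut.
rewrite kern_integrated; apply: Qe => Qst; apply: Qg.
exists (s * ((1 * s)^-1 * (g * t)), t^-1)%g => /=.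
  by split; [exists (s, ((1 * s)^-1 * (g * t))%g)|exists t].
by rewrite mul1g mulVKg mulgK.
Qed.

End fixed_multiplier.

(** Pointwise convergence and an equicontinuity neighbourhood that is the same for all n. *)
Lemma transferred_cvg (W : nat -> set X) (phi : nat -> H -> R[i]^o)
    (F : nat -> bool -> bool -> H -> H -> R[i]) (m : nat -> bool -> R) (M : R) :
  (forall n, measurable (W n)) -> (forall n, continuous (phi n)) ->
  (forall n, multiplier_kernel (phi n) (F n) (m n)) ->
  (forall n, m n false * m n true <= M) ->
  (fun n => fine (mu (~` W n))) @ \oo --> (0 : R) ->
  cvg_to_1_on_compacts phi ->
  cvg_to_1_on_compacts (fun n => transferred (W n) (F n false true)).
Proof.
move=> mW cphi FK mM W0 phi1; apply/cvg_to_1P => Q cQ e e0.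
have phib n := multiplier_bounded_meas (cphi n) (FK n).
have phi_pt h : (fun n => cabs ((phi n h : R[i]) - 1)) @ \oo --> (0 : R).
  apply/cvgrPdist_lt => d d0.
  have := (cvg_to_1P phi).1 phi1 [set h] (@compact_set1 _ h) d d0.
  apply: filterS => n /(_ h erefl); rewrite sub0r normrN ger0_norm ?cabs_ge0//.
have v_pt r : (fun n => cabs (integrated (W n) (phi n) r - 1)) @ \oo --> (0 : R).
  apply: (@integrated_cvg _ _ _ _ _ mu actX omega m_act m_omega invariant W phi M) => //.
  - by move=> n; exact: (phib n).1.
  - by move=> n h; exact: le_trans ((phib n).2 h) (mM n).
have kM n s t : cabs (kern (W n) (F n false true) s t) <= 2 * M.
  by rewrite (le_trans (kern_le (mW n) (FK n) _ _ _ _))// ler_pM2l.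
have bk n := kern_meas (mW n) (FK n) false true.
have u_pt g : (fun n => cabs (transferred (W n) (F n false true) g - 1)) @ \oo --> (0 : R).
  have k_pt s t : (fun n => cabs (kern (W n) (F n false true) s t - 1)) @ \oo --> (0 : R).
    rewrite (_ : (fun n => _) = fun n => cabs (integrated (W n) (phi n) (s^-1 * t)%g - 1)); first exact: v_pt.
    by apply/funext => n; rewrite (kern_integrated (mW n) (cphi n) (FK n) s t).
  exact: (smooth_cvg P 1%g g bk kM k_pt).
have M0 : 0 <= 2 * M by exact: le_trans (cabs_ge0 _) (kM 0 1%g 1%g).
have e1 : 0 < e / 2 / (2 * M + 1) by rewrite !divr_gt0// ltr_wpDl.
have /compact_near_coveringP := cQ; apply => g Qg.
have near1 : \forall g' \near g, forall n,
    cabs (transferred (W n) (F n false true) g - transferred (W n) (F n false true) g') < e / 2.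
  apply: filterS (smooth_equicontinuous P_continuous g e1) => g' Hg' n.
  have [_ h1] := Hg' _ _ (bk n) (kM n) 1%g.
  apply: (le_lt_trans h1).
  by rewrite mulrAC ltr_pdivrMr ?ltr_wpDl// ltr_pM2l ?divr_gt0// ltrDl.
have near2 : \forall n \near \oo, cabs (transferred (W n) (F n false true) g - 1) < e / 2.
  have e2 : 0 < e / 2 by rewrite divr_gt0.
  have /cvgrPdist_lt/(_ _ e2) := u_pt g.
  by apply: filterS => n; rewrite sub0r normrN ger0_norm ?cabs_ge0.
exists ([set g' | forall n, cabs (transferred (W n) (F n false true) g -
    transferred (W n) (F n false true) g') < e / 2],
  [set n | cabs (transferred (W n) (F n false true) g - 1) < e / 2]) => //.
move=> [g' n] [/= /(_ n) + +].
move: (transferred (W n) _ g) (transferred (W n) _ g') => a b h1 h2.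
have -> : (b : R[i]) - 1 = - ((a : R[i]) - b) + ((a : R[i]) - 1) by ring.
apply: (le_lt_trans (cabsD _ _)); rewrite cabsN.
by have := ltrD h1 h2; rewrite -splitr.
Qed.

Hypothesis proper : forall (L : set H) (e : R), compact L -> 0 < e ->
  exists (X0 : set X) (Q : set G),
  [/\ measurable X0, (mu (~` X0) < e%:E)%E, compact Q &
      forall r, ~ Q r -> \forall x \ae mu, ~ (X0 x /\ X0 (actX r x) /\ L (omega (r, x)))].

Lemma fine_mu_lt (A : set X) (e : R) : measurable A -> (mu A < e%:E)%E -> fine (mu A) < e.
Proof. by move=> mA h; rewrite -lte_fin fineK// fin_num_measure. Qed.

(** Where phi is small outside L, the transferred function is small outside a compact set,
    up to the error of cutting X to a set X0 on which the cocycle is proper. *)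
Lemma transferred_vanishing phi F m : continuous phi -> multiplier_kernel phi F m ->
  vanishes_at_infinity phi -> vanishes_at_infinity (transferred setT (F false true)).
Proof.
move=> cphi FK phi0 e e0; have [bphi phiM] := multiplier_bounded_meas cphi FK.
set M := m false * m true in phiM.
have M0 : 0 <= M by exact: le_trans (cabs_ge0 _) (phiM 1%g).
have e1 : 0 < e / 32 by rewrite divr_gt0.
have [L cL phiL] := phi0 _ e1.
have e2 : 0 < e / 64 / (M + 1) by rewrite !divr_gt0// ltr_wpDl.
have [X0 [Q [mX0 X0small cQ QX0]]] := proper cL e2.
have phiL' h : ~ L h -> cabs (phi h) <= e / 32.
  by move=> /phiL /ltW; rewrite -cabsE.
pose e' := 2 * (e / 32) + 4 * M * (e / 64 / (M + 1)).
have e'0 : 0 <= e'.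
  by have h1 := ltW e1; have h2 := ltW e2; rewrite addr_ge0// mulr_ge0// mulr_ge0.
have Qe r : ~ Q r -> cabs (integrated setT phi r) <= e'.
  move=> Qr; have -> : integrated setT phi r =
    integrated X0 phi r - (integrated X0 phi r - integrated setT phi r) by rewrite opprB addrC subrK.
  apply: (le_trans (cabsB _ _)); apply: lerD.
    exact: (integrated_small m_act m_omega mX0 cL bphi (ltW e1) phiL' (QX0 r Qr)).
  apply: (le_trans (integrated_cut m_act m_omega invariant r mX0 bphi phiM)).
  apply: ler_wpM2l; first by rewrite mulr_ge0.
  by apply/ltW/fine_mu_lt => //; exact: measurableC.
have [Q' cQ' HQ'] := transferred_small measurableT cphi FK cQ e'0 Qe.
exists Q' => // g /HQ'; rewrite -cabsE /=; move/le_lt_trans; apply.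
have : M * (e / 64 / (M + 1)) <= e / 64.
  rewrite mulrCA; apply: ler_piMr; first by rewrite divr_ge0// ltW.
  by rewrite ler_pdivrMr ?mul1r ?lerDl// ltr_wpDl.
rewrite /e'; move: (e / 64 / (M + 1)) => t; rewrite -(mulrA 4 M t).
by move: (M * t) => z; lra.
Qed.

(** Here the cut of X has to stay in the transferred function, since an error term would
    spoil the support. *)
Lemma transferred_compact_support phi F m (e : R) : continuous phi -> multiplier_kernel phi F m ->
  compactly_supported phi -> 0 < e ->
  exists W : set X, [/\ measurable W, (mu (~` W) < e%:E)%E &
    compactly_supported (transferred W (F false true))].
Proof.
rewrite /compactly_supported => cphi FK; set L : set H := closure [set g | phi g != 0] => cL e0.
have [bphi _] := multiplier_bounded_meas cphi FK.
have [W [Q [mW Wsmall cQ QW]]] := proper cL e0.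
have phiL h : ~ L h -> cabs (phi h) <= 0.
  move=> Lh; rewrite (_ : phi h = 0) ?cabs0//; apply/eqP; rewrite -[_ == _]negbK; apply/negP => h0.
  by apply: Lh; exact: subset_closure.
have Qe r : ~ Q r -> cabs (integrated W phi r) <= 0.
  move=> Qr; rewrite -[leRHS](mulr0 2).
  exact: (integrated_small m_act m_omega mW cL bphi (lexx 0) phiL (QW r Qr)).
have [Q' cQ' HQ'] := transferred_small mW cphi FK cQ (lexx 0) Qe.
exists W; split => //; apply: (subclosed_compact _ cQ'); first exact: closed_closure.
have /closure_id -> := compact_closed (@lcsc_hausdorff G) cQ'.
apply: closureS => g /= /negP tg; apply: contrapT => /HQ'.
rewrite mulr0 => h; apply: tg; apply/eqP/cabs_eq0/eqP.
by rewrite eq_le h cabs_ge0.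
Qed.

Lemma cut_setT : (fun n : nat => fine (mu (~` (setT : set X)))) @ \oo --> (0 : R).
Proof. by rewrite setCT measure0; exact: cvg_cst. Qed.

(** The uniform bound on the multipliers comes from their values at 1, which are at most 2
    from some N on. *)
Lemma haagerup_transfer : haagerup_property R H -> haagerup_property R G.
Proof.
move=> [phi [phiP phi1]].
have [N _ HN] := (cvg_to_1P phi).1 phi1 [set 1%g] (@compact_set1 _ 1%g) 1 ltr01.
pose psi n := phi (n + N)%N.
have psiP n := phiP (n + N)%N.
have psi1 : cvg_to_1_on_compacts psi.
  apply/cvg_to_1P => K cK e e0; have [N' _ HN'] := (cvg_to_1P phi).1 phi1 K cK e e0.
  by exists N' => // n N'n; apply: HN' => /=; exact: leq_trans N'n (leq_addr _ _).
pose F n (_ _ : bool) (h h' : H) : R[i] := psi n (h^-1 * h')%g.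
pose m n (_ : bool) : R := Num.sqrt (complex.Re (psi n 1%g)).
have FK n : multiplier_kernel (psi n) (F n) (m n).
  by have [c p _] := psiP n; exact: positive_type_multiplier_kernel.
have cpsi n : continuous (psi n) by have [] := psiP n.
have mM n : m n false * m n true <= 2.
  have [_ p _] := psiP n.
  have p0 := le_trans (cabs_ge0 _) (positive_type_le 1%g p).
  rewrite -expr2 sqr_sqrtr//.
  have := HN (n + N)%N (leq_addl _ _) 1%g erefl; rewrite -/(psi n) => h.
  have := le_lt_trans (normr_Re_le _) h; rewrite raddfB/= ltr_norml => /andP[_].
  by rewrite ltrBlDr => /ltW; rewrite -[1 + 1]/(2%:R).
exists (fun n => transferred setT (F n false true)); split.
  move=> n; split.
  - exact: (transferred_continuous measurableT (FK n)).
  - exact: (transferred_positive_type measurableT (cpsi n) (FK n)).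
  - by have [_ _ v] := psiP n; exact: (transferred_vanishing (cpsi n) (FK n)).
exact: (transferred_cvg (fun=> measurableT) cpsi FK mM cut_setT psi1).
Qed.

Lemma herz_schur_kernels (C : R) (phi : nat -> H -> R[i]^o) :
  (forall n, herz_schur_multiplier (phi n)) -> (forall n, herz_schur_norm (phi n) <= C) ->
  exists (F : nat -> bool -> bool -> H -> H -> R[i]) (m : nat -> bool -> R),
    (forall n, multiplier_kernel (phi n) (F n) (m n)) /\
    (forall n, m n false * m n true <= C + 1).
Proof.
move=> phiHS phiC.
have H' n : exists Fm : (bool -> bool -> H -> H -> R[i]) * (bool -> R),
    multiplier_kernel (phi n) Fm.1 Fm.2 /\ Fm.2 false * Fm.2 true <= C + 1.
  have [F [m FK]] := herz_schur_multiplier_kernel (phiHS n) (phiC n).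
  by exists (F, m).
have [f fP] := choice H'.
by exists (fun n => (f n).1), (fun n => (f n).2); split => n; have [] := fP n.
Qed.

Lemma weak_haagerup_transfer : weak_haagerup_property R H -> weak_haagerup_property R G.
Proof.
move=> [C [phi [C1 phiP phi1]]].
have [F [m [FK mC]]] := @herz_schur_kernels C phi (fun n => let: And3 a _ _ := phiP n in a)
  (fun n => let: And3 _ _ c := phiP n in c).
have cphi n : continuous (phi n) by have [[]] := phiP n.
exists (9 * (C + 1)), (fun n => transferred setT (F n false true)); split.
- lra.
- move=> n; have [hs hsn] := transferred_herz_schur measurableT (cphi n) (FK n); split => //.
    by have [_ v _] := phiP n; exact: (transferred_vanishing (cphi n) (FK n)).
  by apply: (le_trans hsn); rewrite ler_pM2l.
- exact: (transferred_cvg (fun=> measurableT) cphi FK mC cut_setT phi1).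
Qed.

(** The cut W n has complement of measure less than 1 / (n + 1), so that the transferred
    functions still converge to 1. *)
Lemma weakly_amenable_transfer : weakly_amenable R H -> weakly_amenable R G.
Proof.
move=> [C [phi [C1 phiP phi1]]].
have [F [m [FK mC]]] := @herz_schur_kernels C phi (fun n => let: And3 a _ _ := phiP n in a)
  (fun n => let: And3 _ _ c := phiP n in c).
have cphi n : continuous (phi n) by have [[]] := phiP n.
have HW n : exists W : set X, [/\ measurable W, (mu (~` W) < (n.+1%:R^-1)%:E)%E &
    compactly_supported (transferred W (F n false true))].
  have [_ s _] := phiP n.
  by apply: (transferred_compact_support (cphi n) (FK n) s); rewrite invr_gt0.
have [W WP] := choice HW.
have mW n : measurable (W n) by have [] := WP n.
have W0 : (fun n => fine (mu (~` W n))) @ \oo --> (0 : R).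
  apply: (@squeeze_cvgr _ _ _ _ (cst 0) (fun n => n.+1%:R^-1)); last 2 first.
  - exact: cvg_cst.
  - exact: cvg_harmonic.
  apply: nearW => n; rewrite fine_ge0//=.
  by apply/ltW/fine_mu_lt; [exact: measurableC|have [] := WP n].
exists (9 * (C + 1)), (fun n => transferred (W n) (F n false true)); split.
- lra.
- move=> n; have [hs hsn] := transferred_herz_schur (mW n) (cphi n) (FK n); split => //.
    by have [] := WP n.
  by apply: (le_trans hsn); rewrite ler_pM2l.
- exact: (transferred_cvg mW cphi FK mC W0 phi1).
Qed.

End transfer.

Theorem mainTheorem5 (R : realType) (G H : lcscGroupType)
    (lamG : {sigma_finite_measure set (borel G) -> \bar R})
    (lamH : {sigma_finite_measure set (borel H) -> \bar R}) :
  haar_measure lamG -> haar_measure lamH ->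
  measure_equivalence_subgroup lamG lamH ->
  [/\ haagerup_property R H -> haagerup_property R G,
      weakly_amenable R H -> weakly_amenable R G &
      weak_haagerup_property R H -> weak_haagerup_property R G].
Proof.
move=> haarG haarH [dO [ W [eta [act [[_ _ [dY [Y [nu [psi [_ psi_iso psi_act]]]]]] sub]]]]].
have [dX [X [mu [phi [actX [omega [[_ phi_iso _] assoc [mu' [dom dom' inv]]]]]]]]] := sub.
have [[_ act1 actM m_act _] m_omega cocycle phi_act] := assoc.
have proper L e : compact L -> 0 < e -> _ :=
  @cocycle_proper R G H lamG lamH haarG haarH dO W eta (fun g => act (g, 1%g))
    dY Y nu psi psi_iso psi_act dX X mu phi phi_iso actX omega phi_act mu' L e dom'.
have cocycle' g k : \forall x \ae mu', omega ((g * k)%g, x) =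
    (omega (g, actX k x) * omega (k, x))%g.
  have [N [mN N0 sN]] := cocycle g k; exists N; split => //.
  exact: (null_content_dominatesP mu' mu).1 dom' N mN N0.
have [U [P [cU PU Pc]]] := @averaging_probability R G lamG haarG.
split.
- exact: (haagerup_transfer act1 actM m_act m_omega cocycle' inv cU PU Pc proper).
- exact: (weakly_amenable_transfer act1 actM m_act m_omega cocycle' inv cU PU Pc proper).
- exact: (weak_haagerup_transfer act1 actM m_act m_omega cocycle' inv cU PU Pc proper).
Qed.
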